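(* Fix $\beta\ge1$. Let $\{X_i\}_{i\ge1}$ be a sequence of independent random variables in a sub-linear expectation space $(\Omega,\mathscr H,\mathbb E)$ with $\mathbb E[X_i]=\mathbb E[-X_i]=0$, $\overline\sigma_i:=\sqrt{\mathbb E[X_i^2]}$, $\underline\sigma_i:=\sqrt{-\mathbb E[-X_i^2]}$, $\overline\sigma_i/\underline\sigma_i=\beta$ for all $i$, and $0<\inf_i\underline\sigma_i^2\le\sup_i\overline\sigma_i^2<\infty$. Put $S_n=\sum_{i=1}^nX_i$, $\sigma_i=(\underline\sigma_i+\overline\sigma_i)/2$, $B_n=\sqrt{\sum_{i=1}^n\sigma_i^2}$, $W_n=S_n/B_n$. Assume the continuity condition (A) below holds for $(\Omega,\mathscr H,\mathbb E)$ and $(\widetilde\Omega,\widetilde{\mathscr H},\widetilde{\mathbb E})$. Let $\alpha\in(0,1)$ be the constant (depending on $\beta$) from Song's convergence-rate theorem described in the context. If $\sup_{i\ge1}\mathbb E[|X_i|^{2+\alpha}]<\infty$, then for every $f\in\mathcal H$, $$\nu\Big(\lim_{n\to\infty}\frac{1}{\log n}\sum_{k\le n}\frac1k f(W_k)=\widetilde{\mathbb E}[f(\xi)]\Big)=1,$$ where $\xi$ is $G$-normally distributed under $\widetilde{\mathbb E}$ with $\sqrt{\widetilde{\mathbb E}[\xi^2]}=\frac{2\beta}{1+\beta}$ and $\sqrt{-\widetilde{\mathbb E}[-\xi^2]}=\frac{2}{1+\beta}$.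
   Context: Sub-linear expectation space $(\Omega,\mathscr H,\mathbb E)$: $(\Omega,\mathcal F)$ a measurable space, $\mathscr H$ a linear space of real measurable functions closed under $(X_1,\dots,X_n)\mapsto\varphi(X_1,\dots,X_n)$ for $\varphi\in C_{b,Lip}(\mathbb R^n)$ (bounded Lipschitz functions), and $\mathbb E:\mathscr H\to\mathbb R$ monotone, constant preserving, sub-additive and positively homogeneous; it is assumed $\mathbb E[X]=\sup_{P\in\mathcal P}E_P[X]$ for a family $\mathcal P$ of $\sigma$-additive probability measures, and $\nu(A)=\inf_{P\in\mathcal P}P(A)$. $(\widetilde\Omega,\widetilde{\mathscr H},\widetilde{\mathbb E})$ is another sub-linear expectation space. Independence: $Y\in\mathscr H^n$ is independent of $X\in\mathscr H^m$ if $\mathbb E[\varphi(X,Y)]=\mathbb E\big[\mathbb E[\varphi(x,Y)]|_{x=X}\big]$ for all $\varphi\in C_{b,Lip}(\mathbb R^{m+n})$ (whenever the relevant quantities are finite); $\{X_n\}$ is independent if $X_{n+1}$ is independent of $(X_1,\dots,X_n)$ for every $n$. Condition (A): for every $X\in\mathscr H$ (resp. $\widetilde{\mathscr H}$) and every sequence $f_n\in C_{b,Lip}(\mathbb R)$ with $f_n\downarrow0$, $\mathbb E[f_n(X)]\downarrow0$ (resp. $\widetilde{\mathbb E}[f_n(X)]\downarrow0$). $G$-normal distribution: $\xi$ is $G$-normal under $\widetilde{\mathbb E}$ if for each $f\in C_{b,Lip}(\mathbb R)$, $u(t,x)=\widetilde{\mathbb E}[f(x+\sqrt t\,\xi)]$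 is the unique viscosity solution of $\partial_tu-G(\partial_{xx}u)=0$ on $(0,\infty)\times\mathbb R$, $u(0,x)=f(x)$, where $G(a)=\frac12\widetilde{\mathbb E}[a\xi^2]$. $\mathcal H:=\{f\in C_{b,Lip}(\mathbb R):\widetilde{\mathbb E}[f(\xi)]=-\widetilde{\mathbb E}[-f(\xi)]\}$. Song's theorem (cited, Theorem 5.1 of Song): there exist $\alpha\in(0,1)$ depending on $\beta$ and $C_{\alpha,\beta}>0$ such that for every sequence as in the claim and every $n\ge1$, $\sup_{|f|_{Lip}\le1}\big|\mathbb E[f(W_n)]-\widetilde{\mathbb E}[f(\xi)]\big|\le C_{\alpha,\beta}\sup_{1\le i\le n}\Big\{\frac{\mathbb E[|X_i|^{2+\alpha}]}{\sigma_i^{2+\alpha}}\big(\frac{\sigma_i}{B_n}\big)^{\alpha}\Big\}$, with $\xi$ as in the claim. The $\alpha$ in the claim is this constant. *)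

(* Defs.v *)
(* Sub-linear expectation spaces represented by a
   family of (sigma-additive) probability measures, as assumed in the paper. *)
From HB Require Import structures.
From mathcomp Require Import all_boot all_order all_algebra.
From mathcomp Require Import all_classical all_reals all_analysis.
Set Implicit Arguments. Unset Strict Implicit. Unset Printing Implicit Defensive.
Import Order.TTheory GRing.Theory Num.Theory.
Import numFieldNormedType.Exports.
Local Open Scope classical_set_scope.
Local Open Scope ring_scope.

Section SubLinear.
Context {d : measure_display} {T : measurableType d} {R : realType}.

Definition uE (Ps : set (probability T R)) (X : T -> R) : \bar R :=
  ereal_sup [set (\int[mu]_w (X w)%:E)%E | mu in Ps].

Definition lcap (Ps : set (probability T R)) (A : set T) : \bar R :=
  ereal_inf [set mu A | mu in Ps].

End SubLinear.

Definition cblip {R : realType} (n : nat) (phi : ('I_n -> R) -> R) : Prop :=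
  (exists M : R, forall x, `|phi x| <= M) /\
  (exists L : R, forall x y, `|phi x - phi y| <= L * \sum_(i < n) `|x i - y i|).

Definition cblip2 {R : realType} (m : nat) (phi : ('I_m -> R) -> R -> R) : Prop :=
  (exists M : R, forall x y, `|phi x y| <= M) /\
  (exists L : R, forall x x' y y',
      `|phi x y - phi x' y'| <= L * (\sum_(i < m) `|x i - x' i| + `|y - y'|)).

Definition cblip1 {R : realType} (f : R -> R) : Prop :=
  (exists M : R, forall x, `|f x| <= M) /\
  (exists L : R, forall x y, `|f x - f y| <= L * `|x - y|).

(* (Omega, H, E) with E = sup_{P in Ps} E_P is a sub-linear expectation space:
   H is a linear space of measurable functions closed under C_{b,Lip}
   composition, and E : H -> R (finite, each E_P[X] defined). *)
Definition sublinear_space {d} {T : measurableType d} {R : realType}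
    (Ps : set (probability T R)) (H : set (T -> R)) : Prop :=
  [/\ Ps !=set0,
      (forall X Y, H X -> H Y -> H (X \+ Y)) /\
      (forall (a : R) X, H X -> H (fun w => a * X w)),
      (forall n (Xs : 'I_n -> T -> R) phi, (forall i, H (Xs i)) -> cblip phi ->
          H (fun w => phi (fun i => Xs i w))),
      (forall X, H X -> measurable_fun setT X) &
      (forall X, H X ->
         (forall mu, Ps mu -> mu.-integrable setT (fun w => (X w)%:E)) /\
         (uE Ps X < +oo)%E)].

Definition indep {d} {T : measurableType d} {R : realType}
    (Ps : set (probability T R)) (m : nat) (Xs : 'I_m -> T -> R) (Y : T -> R) : Prop :=
  forall phi : ('I_m -> R) -> R -> R, cblip2 phi ->
    uE Ps (fun w => phi (fun i => Xs i w) (Y w)) =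
    uE Ps (fun w => fine (uE Ps (fun w' => phi (fun i => Xs i w) (Y w')))).

Definition indep_seq {d} {T : measurableType d} {R : realType}
    (Ps : set (probability T R)) (X : nat -> T -> R) : Prop :=
  forall n, indep Ps (fun i : 'I_n => X (nat_of_ord i)) (X n).

Definition condA {d} {T : measurableType d} {R : realType}
    (Ps : set (probability T R)) (H : set (T -> R)) : Prop :=
  forall X, H X -> forall fs : nat -> R -> R,
    (forall n, cblip1 (fs n)) ->
    (forall n x, fs n.+1 x <= fs n x) ->
    (forall x, fs n x @[n --> \oo] --> 0) ->
    uE Ps (fun w => fs n (X w)) @[n --> \oo] --> 0%E.

Definition sbar {d} {T : measurableType d} {R : realType}
    (Ps : set (probability T R)) (X : T -> R) : R :=
  Num.sqrt (fine (uE Ps (fun w => X w ^+ 2))).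
Definition slow {d} {T : measurableType d} {R : realType}
    (Ps : set (probability T R)) (X : T -> R) : R :=
  Num.sqrt (- fine (uE Ps (fun w => - X w ^+ 2))).

(* sigma_i = (slow_i + sbar_i)/2, B_n, W_n  (X indexed from 0: X i = X_(i+1)) *)
Definition sig {d} {T : measurableType d} {R : realType}
    (Ps : set (probability T R)) (X : nat -> T -> R) (i : nat) : R :=
  (slow Ps (X i) + sbar Ps (X i)) / 2.
Definition Bn {d} {T : measurableType d} {R : realType}
    (Ps : set (probability T R)) (X : nat -> T -> R) (n : nat) : R :=
  Num.sqrt (\sum_(i < n) sig Ps X i ^+ 2).
Definition Wn {d} {T : measurableType d} {R : realType}
    (Ps : set (probability T R)) (X : nat -> T -> R) (n : nat) (w : T) : R :=
  (\sum_(i < n) X i w) / Bn Ps X n.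

Definition admissible {d} {T : measurableType d} {R : realType}
    (Ps : set (probability T R)) (H : set (T -> R)) (beta : R)
    (X : nat -> T -> R) : Prop :=
  [/\ (forall i, H (X i)) /\
      indep_seq Ps X,
      (forall i, uE Ps (X i) = 0%E /\ uE Ps (fun w => - X i w) = 0%E),
      (forall i, sbar Ps (X i) / slow Ps (X i) = beta),
      (exists m : R, 0 < m /\ forall i, (m%:E <= - uE Ps (fun w => (- X i w ^+ 2)%R))%E) &
      (exists M : R, forall i, (uE Ps (fun w => (X i w ^+ 2)%R) <= M%:E)%E)].

Definition dt {R : realType} (phi : R -> R -> R) (t x : R) : R :=
  derive1 (fun s => phi s x) t.
Definition dx {R : realType} (phi : R -> R -> R) (t x : R) : R :=
  derive1 (fun y => phi t y) x.
Definition dxx {R : realType} (phi : R -> R -> R) (t x : R) : R :=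
  derive1 (fun y => dx phi t y) x.

Definition C12 {R : realType} (phi : R -> R -> R) : Prop :=
  [/\ (forall t x, derivable (fun s => phi s x) t 1) /\
      (forall t x, derivable (fun y => phi t y) x 1) /\
      (forall t x, derivable (fun y => dx phi t y) x 1),
      continuous (fun p : R * R => phi p.1 p.2),
      continuous (fun p : R * R => dt phi p.1 p.2),
      continuous (fun p : R * R => dx phi p.1 p.2) &
      continuous (fun p : R * R => dxx phi p.1 p.2)].

Definition viscosity_solution {R : realType} (G : R -> R) (f : R -> R)
    (u : R -> R -> R) : Prop :=
  [/\ {within [set p : R * R | 0 <= p.1], continuous (fun p => u p.1 p.2)},
      (forall x, u 0 x = f x),
      (forall t x phi, 0 < t -> C12 phi -> phi t x = u t x ->
          (\forall p \near (t, x), u p.1 p.2 <= phi p.1 p.2) ->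
          dt phi t x - G (dxx phi t x) <= 0) &
      (forall t x phi, 0 < t -> C12 phi -> phi t x = u t x ->
          (\forall p \near (t, x), phi p.1 p.2 <= u p.1 p.2) ->
          0 <= dt phi t x - G (dxx phi t x))].

Definition G_normal {d} {T : measurableType d} {R : realType}
    (Ps : set (probability T R)) (H : set (T -> R)) (xi : T -> R) : Prop :=
  [/\ H xi, (uE Ps (fun w => (xi w ^+ 2)%R) < +oo)%E &
    forall f : R -> R, cblip1 f ->
      viscosity_solution
        (fun a => 2^-1 * fine (uE Ps (fun w => a * xi w ^+ 2)))
        f
        (fun t x => fine (uE Ps (fun w => f (x + Num.sqrt t * xi w))))].

Definition Hclass {d} {T : measurableType d} {R : realType}
    (Ps : set (probability T R)) (xi : T -> R) (f : R -> R) : Prop :=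
  cblip1 f /\ uE Ps (fun w => f (xi w)) = (- uE Ps (fun w => (- f (xi w))%R))%E.

(* conclusion of Song's Theorem 5.1 for exponent alpha, constant C and the
   sequence Y *)
Definition song_bound {d} {T : measurableType d} {d'} {T' : measurableType d'}
    {R : realType} (Ps : set (probability T R)) (Pt : set (probability T' R))
    (xi : T' -> R) (alpha C : R) (Y : nat -> T -> R) : Prop :=
  forall n : nat, (1 <= n)%N -> forall g : R -> R,
    (forall x y, `|g x - g y| <= `|x - y|) ->
    (`| uE Ps (fun w => g (Wn Ps Y n w)) - uE Pt (fun w => g (xi w)) |
      <= C%:E * \big[Order.max/0%E]_(i < n)
           (uE Ps (fun w => (`|Y i w| `^ (2 + alpha))%R)
             * ((sig Ps Y i `^ (2 + alpha))^-1)%:E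
             * ((sig Ps Y i / Bn Ps Y n) `^ alpha)%:E))%E.

(* Main.v *)
(** Fix [mu] in [Ps] and normalise [f] to a 1-Lipschitz [g] whose mean is [0]
    under every law of [xi]; this is possible because [f] is in the class
    [Hclass]. Conditioning on [X_0, ..., X_{j-1}] and applying Song's bound to
    the shifted sequence shows that [g(W_j)] and the normalised sum of
    [X_j, ..., X_{k-1}] are almost uncorrelated; Song's bound for the test
    function [|x|] controls first moments, hence the error made when that
    normalised sum replaces [W_k]. Together,
    [E_mu[g(W_j) g(W_k)] <= C (j / k) ^ (alpha / 2)] for [j < k]. The second moment of
    [sum_(k <= n) g(W_k) / k] is therefore [O(log n)], which gives almost sure
    convergence along [n_i = 2 ^ ((i + 1) ^ 2)], and boundedness of [g] fills
    the gaps. *)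
Require Import Defs.
From HB Require Import structures.
From mathcomp Require Import all_boot all_order all_algebra.
From mathcomp Require Import all_classical all_reals all_analysis.
From mathcomp Require Import measurable_realfun.
From mathcomp Require Import zify ring lra.
Import Order.TTheory GRing.Theory Num.Theory.
Import numFieldNormedType.Exports.
Local Open Scope classical_set_scope.
Local Open Scope ring_scope.

(** * Logarithmic sums, power sums and a sparse sequence of indices *)

Section RealPreliminaries.
Context {R : realType}.
Implicit Types (z : nat -> R).

(** With [z = cst 1] this is the harmonic number. Starting at [k = 1] keeps out the index 0, where
    [Wn] divides by 0. *)
Definition log_sum z (n : nat) : R := \sum_(1 <= k < n.+1) k%:R^-1 * z k.

Lemma log_sumS z n : log_sum z n.+1 = log_sum z n + n.+1%:R^-1 * z n.+1.
Proof. by rewrite /log_sum big_nat_recr. Qed.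

Lemma log_sum_le (y z : nat -> R) n :
  (forall k, (0 < k <= n)%N -> y k <= z k) -> log_sum y n <= log_sum z n.
Proof.
move=> yz; rewrite /log_sum; apply: ler_sum_nat => k kn.
by rewrite ler_wpM2l ?invr_ge0 // yz.
Qed.

Lemma log_sumZ (c : R) (z : nat -> R) n :
  log_sum (fun k => c * z k) n = c * log_sum z n.
Proof.
by rewrite /log_sum mulr_sumr; apply: eq_bigr => k _; rewrite mulrCA.
Qed.

(** This bound and its companion are both [ln (1 + x) <= x], taken at [x = - 1 / (k + 1)] here and
    at [x = 1 / k] there. *)
Lemma invS_le_ln_diff (k : nat) : (0 < k)%N ->
  k.+1%:R^-1 <= ln k.+1%:R - ln k%:R :> R.
Proof.
move=> k0; have kp : 0 < k%:R :> R by rewrite ltr0n.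
have kS : k.+1%:R = k%:R + 1 :> R by rewrite -natr1.
have kSp : 0 < k.+1%:R :> R by rewrite ltr0n.
rewrite -lerN2 opprB -ln_div ?posrE //.
have -> : k%:R / k.+1%:R = 1 + - k.+1%:R^-1 :> R.
  by rewrite kS; field; rewrite -kS gt_eqF.
by apply: le_ln1Dx; rewrite ltrN2 invf_lt1 // kS; lra.
Qed.

Lemma ln_diff_le_inv (k : nat) : (0 < k)%N ->
  ln k.+1%:R - ln k%:R <= k%:R^-1 :> R.
Proof.
move=> k0; have kp : 0 < k%:R :> R by rewrite ltr0n.
have kSp : 0 < k.+1%:R :> R by rewrite ltr0n.
rewrite -ln_div ?posrE //.
have -> : k.+1%:R / k%:R = 1 + k%:R^-1 :> R.
  by rewrite -natr1; field; rewrite gt_eqF.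
apply: le_ln1Dx; apply: (@lt_trans _ _ 0); first by lra.
by rewrite invr_gt0.
Qed.

Lemma log_sum_cst1_sub_le (m n : nat) : (0 < m <= n)%N ->
  log_sum (cst 1) n - log_sum (cst 1) m <= ln n%:R - ln m%:R :> R.
Proof.
case/andP => m0; elim: n => [|n IHn]; first by rewrite leqn0 => /eqP ->; rewrite !subrr.
rewrite leq_eqVlt => /predU1P[->|]; first by rewrite !subrr.
rewrite ltnS => mn; have := IHn mn; rewrite log_sumS /= mulr1.
have := invS_le_ln_diff n (leq_trans m0 mn).
move: (n.+1%:R^-1) => a. lra.
Qed.

Lemma log_sum_cst1_1 : log_sum (cst 1) 1 = 1 :> R.
Proof. by rewrite /log_sum big_nat1 invr1 mulr1. Qed.

Lemma log_sum_cst1_le (n : nat) : (0 < n)%N ->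
  log_sum (cst 1) n <= 1 + ln n%:R :> R.
Proof.
move=> n0; have := log_sum_cst1_sub_le 1 n n0.
by rewrite log_sum_cst1_1 ln1; lra.
Qed.

Lemma ln_le_log_sum_cst1 (n : nat) : (0 < n)%N ->
  ln n%:R <= log_sum (cst 1) n :> R.
Proof.
case: n => // n _; suff : ln n.+2%:R <= log_sum (cst 1) n.+1 :> R.
  by apply: le_trans; rewrite ler_ln ?posrE ?ltr0n // ler_nat.
elim: n => [|n IHn].
  by have := ln_diff_le_inv 1 isT; rewrite log_sum_cst1_1 ln1 invr1 subr0.
by have := ln_diff_le_inv n.+2 isT; rewrite log_sumS /= mulr1;
  move: (n.+2%:R^-1) => a; lra.
Qed.

Lemma norm_log_sum_sub_le z (M : R) (m n : nat) : (forall k, `|z k| <= M) ->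
  (m <= n)%N ->
  `|log_sum z n - log_sum z m| <= M * (log_sum (cst 1) n - log_sum (cst 1) m).
Proof.
move=> zM; elim: n => [|n IHn].
  by rewrite leqn0 => /eqP ->; rewrite !subrr normr0 mulr0.
rewrite leq_eqVlt => /predU1P[->|]; first by rewrite !subrr normr0 mulr0.
rewrite ltnS => /IHn IH; rewrite !log_sumS /= mulr1 addrAC.
rewrite (addrAC (log_sum (cst 1) n)) mulrDr.
apply: (le_trans (ler_normD _ _)); apply: lerD => //.
by rewrite normrM [leRHS]mulrC normfV normr_nat ler_wpM2l ?invr_ge0.
Qed.

Lemma cvg_ln_natr : ln n%:R @[n --> \oo] --> (+oo : set_system R).
Proof.
apply/cvgryPge => A; near=> n.
rewrite -(expRK A) ler_ln ?posrE ?expR_gt0 //; last by rewrite ltr0n; near: n; exists 1%N.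
by near: n; exact: nbhs_infty_ger.
Unshelve. all: by end_near. Qed.

Lemma cvg_inv_ln_natr : (ln n%:R)^-1 @[n --> \oo] --> (0 : R).
Proof.
apply/gtr0_cvgV0; last exact: cvg_ln_natr.
near=> n; rewrite ln_gt0 // ltr1n; near: n; exists 2%N => //.
Unshelve. all: by end_near. Qed.

Lemma cvg_log_sum_cst1 : (ln n%:R)^-1 * log_sum (cst 1) n @[n --> \oo] --> (1 : R).
Proof.
apply: (@squeeze_cvgr _ _ _ _ (cst 1) (fun n => 1 + (ln n%:R)^-1)).
- near=> n.
  have n1 : (1 < n)%N by near: n; exists 2%N.
  have lnp : 0 < ln n%:R :> R by rewrite ln_gt0 // ltr1n.
  have n0 : (0 < n)%N by exact: ltnW.
  rewrite mulrC ler_pdivlMr // mul1r ln_le_log_sum_cst1 //=.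
  rewrite ler_pdivrMr // mulrDl mulVf ?gt_eqF // mul1r addrC.
  exact: log_sum_cst1_le.
- exact: cvg_cst.
- by rewrite -[X in _ --> X]addr0; apply: cvgD; [exact: cvg_cst|exact: cvg_inv_ln_natr].
Unshelve. all: by end_near. Qed.

(* Along this scale [ln n] grows like [i ^ 2], so that second moments of order
   [1 / ln n] are summable, while consecutive logarithms stay equivalent. *)
Definition sparse (i : nat) : nat := (2 ^ (i.+1 ^ 2))%N.

Lemma sparse_gt0 i : (0 < sparse i)%N. Proof. by rewrite expn_gt0. Qed.

Lemma ln_sparse i : ln (sparse i)%:R = i.+1%:R ^+ 2 * ln 2 :> R.
Proof. by rewrite /sparse natrX lnXn // -(mulr_natl (ln 2)) natrX. Qed.

Lemma sparse_bracket i0 n : (sparse i0 <= n)%N ->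
  exists i, [/\ (i0 <= i)%N, (sparse i <= n)%N & (n < sparse i.+1)%N].
Proof.
move=> h; have ex : exists i, (n < sparse i.+1)%N && (i0 <= i)%N.
  (* Any index at least [n] works, since [n < 2 ^ n]. *)
  exists (maxn n i0); rewrite leq_maxr andbT.
  apply: (leq_ltn_trans (leq_maxl n i0)).
  apply: ltn_trans (ltn_expl _ (isT : (1 < 2)%N)) _.
  rewrite ltn_exp2l // expnS expn1; set m := maxn n i0; nia.
(* Take the least such [i]. If [n < sparse i], then either [i = i0], against the hypothesis, or
   [i - 1] is a smaller candidate. *)
case: (ex_minnP ex) => i /andP[ni ii] mini.
exists i; split=> //; rewrite leqNgt; apply/negP => ni'.
case: i ni ii mini ni' => [|i] ni ii mini ni'.
  by move: ii ni'; rewrite leqn0 => /eqP i00; subst i0; rewrite ltnNge h.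
move: ii; rewrite leq_eqVlt => /predU1P[e|]; first by move: ni'; rewrite -e ltnNge h.
rewrite ltnS => ii; have := mini i; rewrite ni' ii => /(_ isT).
by rewrite ltnn.
Qed.

(** Between consecutive sparse indices [ln] grows by [(2 i + 3) ln 2 <= 3 (i + 1) ln 2], so the sum
    moves by [O(i)] only, while [ln n >= (i + 1) ^ 2 ln 2]. *)
Lemma cvg_log_average z (M : R) : (forall k, `|z k| <= M) ->
  log_sum z (sparse i) / i.+1%:R ^+ 2 @[i --> \oo] --> (0 : R) ->
  (ln n%:R)^-1 * log_sum z n @[n --> \oo] --> (0 : R).
Proof.
move=> zM zs.
have M0 : 0 <= M by exact: le_trans (zM 0%N).
have l2 : 0 < ln 2 :> R by rewrite ln_gt0 // ltr1n.
have cM : (M * ln 2 * 3) * i.+1%:R^-1 @[i --> \oo] --> (0 : R).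
  by rewrite -[X in _ --> X](mulr0 (M * ln 2 * 3)); apply: cvgM;
    [exact: cvg_cst|exact: cvg_harmonic].
apply/cvgrPdist_le => e e0.
(* Half of the tolerance serves the sum at the sparse index, half the gap; the factor [ln 2] comes
   from the lower bound on [ln n]. *)
have e2 : 0 < e * ln 2 / 2 by rewrite divr_gt0 // mulr_gt0.
move/cvgrPdist_le : zs => /(_ _ e2) [i1 _ h1].
move/cvgrPdist_le : cM => /(_ _ e2) [i2 _ h2].
exists (sparse (maxn i1 i2)) => // n /= /(sparse_bracket (maxn i1 i2) n)[i [imax lo hi]].
have := h1 i; rewrite /= => /(_ (leq_trans (leq_maxl _ _) imax)).
have := h2 i; rewrite /= => /(_ (leq_trans (leq_maxr _ _) imax)).
rewrite !sub0r !normrN => b2 b1.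
have i0 : 0 < i.+1%:R :> R by rewrite ltr0n.
have i20 : 0 < i.+1%:R ^+ 2 :> R by rewrite exprn_gt0.
have lnlo : i.+1%:R ^+ 2 * ln 2 <= ln n%:R :> R.
  rewrite -ln_sparse ler_ln ?posrE ?ltr0n ?ler_nat ?sparse_gt0 //.
  exact: leq_trans (sparse_gt0 i) lo.
have gap : `|log_sum z n - log_sum z (sparse i)| <= M * (3 * i.+1%:R * ln 2).
  apply: (le_trans (norm_log_sum_sub_le z M _ _ zM lo)); apply: ler_wpM2l => //.
  apply: (le_trans (log_sum_cst1_sub_le _ _ _)); first by rewrite sparse_gt0.
  have : ln n%:R <= ln (sparse i.+1)%:R :> R.
    rewrite ler_ln ?posrE ?ltr0n ?ler_nat ?sparse_gt0 ?(ltnW hi) //.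
    exact: leq_trans (sparse_gt0 i) lo.
  rewrite !ln_sparse => hh; rewrite lerBlDr; apply: (le_trans hh).
  rewrite -mulrDl ler_pM2r // -[i.+2%:R]natr1.
  have : 1 <= i.+1%:R :> R by rewrite ler1n.
  nra.
have lnp : 0 < ln n%:R :> R by apply: lt_le_trans lnlo; rewrite mulr_gt0.
rewrite normrM (ger0_norm (ltW _)) ?invr_gt0 // mulrC ler_pdivrMr //.
apply: le_trans (ler_wpM2l (ltW e0) lnlo).
rewrite -(subrK (log_sum z (sparse i)) (log_sum z n)).
apply: (le_trans (ler_normD _ _)).
move: b1; rewrite normrM normfV (ger0_norm (ltW i20)) ler_pdivrMr // => b1.
move: b2; rewrite ger0_norm; last by rewrite !mulr_ge0 // ?invr_ge0 ltW.
rewrite ler_pdivrMr // => b2.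
have : M * (3 * i.+1%:R * ln 2) <= e * ln 2 / 2 * i.+1%:R ^+ 2.
  have -> : M * (3 * i.+1%:R * ln 2) = M * ln 2 * 3 * i.+1%:R by ring.
  by rewrite expr2 mulrA ler_pM2r.
lra.
Qed.

(* [1 - x <= exp (- x) <= 1 / (1 + x)] in place of the derivative of [powR],
   at the price of the factor 2. *)
Lemma powR_diff_ge (g : R) (k : nat) : 0 < g <= 1 ->
  k.+1%:R^-1 * k.+1%:R `^ g <= 2 / g * (k.+1%:R `^ g - k%:R `^ g).
Proof.
case/andP => g0 g1; have kp : 0 < k.+1%:R :> R by rewrite ltr0n.
set t : R := k.+1%:R^-1.
have t0 : 0 < t by rewrite invr_gt0.
have t1 : t <= 1 by rewrite invf_le1 // ler1n.
have -> : k%:R = k.+1%:R * (1 - t) :> R by rewrite mulrBr mulfV ?gt_eqF // mulr1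
  -natr1 addrK.
have u0 : 0 <= 1 - t by rewrite subr_ge0.
rewrite powRM ?ler0n //.
set P := k.+1%:R `^ g; have P0 : 0 <= P by exact: powR_ge0.
suff h : (1 - t) `^ g <= 1 - g * t / 2.
  have -> : P - P * (1 - t) `^ g = P * (1 - (1 - t) `^ g) by ring.
  rewrite (mulrCA (2 / g)) (mulrC t) ler_wpM2l // mulrAC ler_pdivlMr //.
  lra.
have gt0 : 0 < g * t by rewrite mulr_gt0.
have gt1 : g * t <= 1 by rewrite -[leRHS]mulr1 ler_pM // ltW.
apply: (@le_trans _ _ (expR (- (g * t)))).
  have h1 : 1 - t <= expR (- t) by exact: expR_ge1Dx.
  apply: (le_trans (ge0_ler_powR (ltW g0) _ _ h1)); rewrite ?nnegrE ?expR_ge0 //.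
  by rewrite -expRM mulNr mulrC.
rewrite expRN; have h2 := expR_ge1Dx (g * t).
rewrite -div1r ler_pdivrMr ?expR_gt0 //.
(* [(1 - x / 2) (1 + x) >= 1] for [0 <= x <= 1], with [x = g * t]. *)
apply: le_trans (ler_wpM2l _ h2); nra.
Qed.

(** The increment bound telescopes; this is a discrete form of integrating [x ^ (g - 1)]. *)
Lemma log_sum_powR_le (g : R) (n : nat) : 0 < g <= 1 ->
  log_sum (fun k => k%:R `^ g) n <= 2 / g * n%:R `^ g.
Proof.
move=> gi; have g0 : 0 < g by case/andP: gi.
elim: n => [|n IHn].
  by rewrite /log_sum big_geq // mulr_ge0 // ?powR_ge0 // divr_ge0 // ltW.
by rewrite log_sumS; have := powR_diff_ge g n gi;
  move: (n.+1%:R^-1 * _) => a; lra.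
Qed.

Lemma powR_invl (a r : R) : 0 <= a -> a^-1 `^ r = (a `^ r)^-1.
Proof.
by move=> a0; rewrite -!powR_inv1 ?powR_ge0 // -!powRrM mulrC.
Qed.

Lemma sum_inv_sqr_le n : \sum_(0 <= i < n) i.+1%:R ^- 2 <= 2 :> R.
Proof.
case: n => [|n]; first by rewrite big_geq.
(* The sharper bound is what induction carries, through [1 / (n + 2) ^ 2 <= 1 / (n + 1) - 1 / (n +
   2)]. *)
suff : \sum_(0 <= i < n.+1) i.+1%:R ^- 2 <= 2 - n.+1%:R^-1 :> R.
  by move=> /le_trans; apply; rewrite gerBl invr_ge0.
elim: n => [|n IHn]; first by rewrite big_nat1 expr1n !invr1; lra.
rewrite big_nat_recr //=.
have n1 : 0 < n.+1%:R :> R by rewrite ltr0n.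
have : n.+2%:R ^- 2 <= n.+1%:R^-1 - n.+2%:R^-1 :> R.
  have -> : n.+2%:R = n.+1%:R + 1 :> R by rewrite -natr1.
  have -> : n.+1%:R^-1 - (n.+1%:R + 1)^-1 = (n.+1%:R * (n.+1%:R + 1))^-1 :> R.
    by field; rewrite !gt_eqF //; lra.
  rewrite lef_pV2 ?posrE; nra.
move: IHn; move: (n.+2%:R ^- 2) (n.+2%:R^-1) (n.+1%:R^-1) => a b c; lra.
Qed.

Lemma cvg0_of_nneseries_fin_num (a : nat -> R) : (forall i, 0 <= a i) ->
  (\sum_(0 <= i <oo) (a i)%:E)%E \is a fin_num -> a @ \oo --> (0 : R).
Proof.
move=> a0 fin; apply: cvg_series_cvg_0; apply: nondecreasing_is_cvgn.
  by apply/nondecreasing_seqP => n; rewrite seriesSr lerDl.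
exists (fine (\sum_(0 <= i <oo) (a i)%:E)%E) => _ [n _ <-].
rewrite -lee_fin fineK // /series /= -sumEFin.
by apply: nneseries_lim_ge => i _ _; rewrite lee_fin.
Qed.

Lemma lee_of_dist (a b : \bar R) (r : R) : b \is a fin_num ->
  (`|a - b| <= r%:E)%E -> (a <= b + r%:E)%E.
Proof.
move=> bfin h; rewrite addeC -leeBlDr //.
by apply: le_trans h; exact: lee_abs.
Qed.

Lemma measurable_Lip1 (g : R -> R) : (forall x y, `|g x - g y| <= `|x - y|) ->
  measurable_fun setT g.
Proof.
move=> lip; apply: continuous_measurable_fun => x.
apply/cvgrPdist_lt => e e0; near=> y; apply: (le_lt_trans (lip x y)).
by near: y; apply: cvgr_dist_lt => //; exact: cvg_id.
Unshelve. all: by end_near. Qed.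

End RealPreliminaries.

(** * Almost sure convergence of logarithmic averages from a covariance decay *)

Section AlmostSureLogAverages.
Context {d : measure_display} {T : measurableType d} {R : realType}
  (mu : probability T R).

(** A class closed under sums and products whose members are integrable under every probability; it
    settles the integrability side conditions below. *)
Definition bounded_mfun (h : T -> R) : Prop :=
  measurable_fun setT h /\ exists M : R, forall w, `|h w| <= M.

Lemma bounded_mfun_integrable h : bounded_mfun h ->
  mu.-integrable setT (EFin \o h).
Proof.
move=> [mh [M hM]]; apply: measurable_bounded_integrable => //.
  by rewrite -ge0_fin_numE // fin_num_measure.
exists M; split; first exact: num_real.
by move=> x Mx w _ /=; rewrite (le_trans (hM w)) // ltW.
Qed.

Lemma bounded_mfunD h1 h2 : bounded_mfun h1 -> bounded_mfun h2 ->
  bounded_mfun (fun w => h1 w + h2 w).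
Proof.
move=> [m1 [M1 b1]] [m2 [M2 b2]]; split; first exact: measurable_funD.
by exists (M1 + M2) => w; rewrite (le_trans (ler_normD _ _)) // lerD.
Qed.

Lemma bounded_mfunM h1 h2 : bounded_mfun h1 -> bounded_mfun h2 ->
  bounded_mfun (fun w => h1 w * h2 w).
Proof.
move=> [m1 [M1 b1]] [m2 [M2 b2]]; split; first exact: measurable_funM.
by exists (M1 * M2) => w; rewrite normrM ler_pM.
Qed.

Lemma bounded_mfun_cst (c : R) : bounded_mfun (fun=> c).
Proof. by split; [exact: measurable_cst | exists `|c|]. Qed.

Lemma Rintegral_cst_prob (c : R) : \int[mu]_w c = c.
Proof.
by rewrite Rintegral_cst //= probability_setT mulr1.
Qed.

Lemma bounded_mfun_log_sum (Z : nat -> T -> R) n :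
  (forall k, bounded_mfun (Z k)) -> bounded_mfun (fun w => log_sum (Z^~ w) n).
Proof.
move=> bZ; elim: n => [|n IHn].
  under eq_fun do rewrite /log_sum big_geq //; exact: bounded_mfun_cst.
under eq_fun do rewrite log_sumS.
by apply: bounded_mfunD => //; apply: bounded_mfunM => //; exact: bounded_mfun_cst.
Qed.

Lemma Rintegral_log_sumM (Z : nat -> T -> R) (h : T -> R) n :
  (forall k, bounded_mfun (Z k)) -> bounded_mfun h ->
  \int[mu]_w (log_sum (Z^~ w) n * h w) =
  log_sum (fun k => \int[mu]_w (Z k w * h w)) n.
Proof.
move=> bZ bh; elim: n => [|n IHn].
  under eq_Rintegral do rewrite /log_sum big_geq // mul0r.
  by rewrite Rintegral_cst_prob /log_sum big_geq.
under eq_Rintegral do rewrite log_sumS mulrDl -mulrA.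
rewrite log_sumS -IHn RintegralD //.
- congr (_ + _); rewrite RintegralZl //.
  exact/bounded_mfun_integrable/bounded_mfunM.
- by apply/bounded_mfun_integrable/bounded_mfunM => //; exact: bounded_mfun_log_sum.
- apply/bounded_mfun_integrable/bounded_mfunM; first exact: bounded_mfun_cst.
  exact: bounded_mfunM.
Qed.

(** Expanding the square at each step, the cross term is [2 / (n + 1)] times a quantity bounded
    uniformly in [n], and the new square is at most [M ^ 2 / (n + 1)]. The second moment thus grows
    no faster than the harmonic number. *)
Lemma Rintegral_sqr_log_sum_le (Z : nat -> T -> R) (M C g : R) n :
  (forall k, measurable_fun setT (Z k)) -> (forall k w, `|Z k w| <= M) ->
  0 <= C -> 0 < g <= 1 ->
  (forall j k, (0 < j < k)%N ->
    \int[mu]_w (Z j w * Z k w) <= C * (j%:R `^ g / k%:R `^ g)) ->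
  \int[mu]_w (log_sum (Z^~ w) n ^+ 2) <=
    (2 * (C * (2 / g)) + M ^+ 2) * log_sum (cst 1) n.
Proof.
move=> mZ ZM C0 gi cov; have g0 : 0 < g by case/andP: gi.
have bZ k : bounded_mfun (Z k) by split; [exact: mZ | exists M].
elim: n => [|n IHn].
  under eq_Rintegral do rewrite /log_sum big_geq // expr0n.
  by rewrite Rintegral_cst_prob /log_sum big_geq // mulr0.
set a : R := n.+1%:R^-1.
have a0 : 0 < a by rewrite invr_gt0 ltr0n.
have a1 : a <= 1 by rewrite invf_le1 ?ltr0n // ler1n.
have bS := bounded_mfun_log_sum _ n bZ.
(* The weighted sum of the [k ^ g] is at most [(2 / g) n ^ g], which the denominator [(n + 1) ^ g]
   absorbs. *)
have cross : \int[mu]_w (log_sum (Z^~ w) n * Z n.+1 w) <= C * (2 / g).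
  rewrite Rintegral_log_sumM //.
  apply: (@le_trans _ _ (log_sum (fun k => C / n.+1%:R `^ g * k%:R `^ g) n)).
    apply: log_sum_le => k kn; apply: (le_trans (cov k n.+1 _)) => //.
    by rewrite -mulrA (mulrC (_^-1)).
  have p0 : 0 < n.+1%:R `^ g by apply: powR_gt0; rewrite ltr0n.
  rewrite log_sumZ -mulrA ler_wpM2l // mulrC ler_pdivrMr //.
  apply: (le_trans (log_sum_powR_le g n gi)).
  apply: ler_wpM2l; first by rewrite divr_ge0 // ltW.
  by apply: ge0_ler_powR; rewrite ?nnegrE ?ler_nat ?ler0n // ltW.
have sq : \int[mu]_w (Z n.+1 w * Z n.+1 w) <= M ^+ 2.
  rewrite -[leRHS]Rintegral_cst_prob; apply: le_Rintegral => //.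
  - exact/bounded_mfun_integrable/bounded_mfunM.
  - exact/bounded_mfun_integrable/bounded_mfun_cst.
  - move=> w _; rewrite -expr2 -real_normK ?num_real // lerXn2r ?nnegrE //.
    exact: le_trans (ZM n w).
have bM c h1 h2 : bounded_mfun h1 -> bounded_mfun h2 ->
    mu.-integrable setT (EFin \o (fun w => c * (h1 w * h2 w))).
  move=> b1 b2; apply/bounded_mfun_integrable/bounded_mfunM;
    first exact: bounded_mfun_cst.
  exact: bounded_mfunM.
have bM1 h1 h2 : bounded_mfun h1 -> bounded_mfun h2 ->
    mu.-integrable setT (EFin \o (fun w => h1 w * h2 w)).
  by move=> b1 b2; exact/bounded_mfun_integrable/bounded_mfunM.
have -> : \int[mu]_w (log_sum (Z^~ w) n.+1 ^+ 2) =
    \int[mu]_w (log_sum (Z^~ w) n ^+ 2)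
    + (2 * a * \int[mu]_w (log_sum (Z^~ w) n * Z n.+1 w)
    + a ^+ 2 * \int[mu]_w (Z n.+1 w * Z n.+1 w)).
  rewrite -(RintegralZl (2 * a)) //; last exact: bM1.
  rewrite -(RintegralZl (a ^+ 2)) //; last exact: bM1.
  rewrite -RintegralD //; [|exact: bM|exact: bM].
  rewrite -RintegralD //; [|exact: bM1|].
    by apply: eq_Rintegral => w _; rewrite log_sumS -/a; ring.
  apply/bounded_mfun_integrable/bounded_mfunD; apply: bounded_mfunM;
    by [exact: bounded_mfun_cst | exact: bounded_mfunM].
rewrite log_sumS /= mulr1 mulrDr -/a; apply: lerD => //.
rewrite [leRHS]mulrDl; apply: lerD.
  by rewrite mulrAC ler_pM2r // ler_pM2l.
have M2 : 0 <= M ^+ 2 by exact: sqr_ge0.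
apply: (le_trans (ler_wpM2l (sqr_ge0 a) sq)).
have aM : 0 <= a * M ^+ 2 by rewrite mulr_ge0 // ltW.
by rewrite expr2 -mulrA (mulrC (M ^+ 2)) -[leRHS]mul1r ler_wpM2r.
Qed.

(** The squared averages [a i] along the sparse indices have summable expectations, so their series
    is finite almost everywhere and [a i] tends to 0 there; boundedness then passes to all [n]. *)
Lemma ae_cvg_log_average (Z : nat -> T -> R) (M C g : R) :
  (forall k, measurable_fun setT (Z k)) -> (forall k w, `|Z k w| <= M) ->
  0 <= C -> 0 < g <= 1 ->
  (forall j k, (0 < j < k)%N ->
    \int[mu]_w (Z j w * Z k w) <= C * (j%:R `^ g / k%:R `^ g)) ->
  {ae mu, forall w, (ln n%:R)^-1 * log_sum (Z^~ w) n @[n --> \oo] --> (0 : R)}.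
Proof.
move=> mZ ZM C0 gi cov; have g0 : 0 < g by case/andP: gi.
have bZ k : bounded_mfun (Z k) by split; [exact: mZ | exists M].
pose a i w := (log_sum (Z^~ w) (sparse i) / i.+1%:R ^+ 2) ^+ 2.
have ba i : bounded_mfun (a i).
  have b1 : bounded_mfun (fun w => log_sum (Z^~ w) (sparse i) / i.+1%:R ^+ 2).
    by apply: bounded_mfunM; [exact: bounded_mfun_log_sum|exact: bounded_mfun_cst].
  exact: bounded_mfunM.
have a0 i w : 0 <= a i w by exact: sqr_ge0.
have ma i : measurable_fun setT (fun w => (a i w)%:E).
  by apply/measurable_EFinP; case: (ba i).
pose K := 2 * (C * (2 / g)) + M ^+ 2.
have K0 : 0 <= K.
  by rewrite addr_ge0 ?sqr_ge0 // !mulr_ge0 // invr_ge0 ltW.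
(* With [q = (i + 1) ^ 2], the harmonic number at [sparse i] is at most [1 + q ln 2 <= 2 q], and
   dividing by [q ^ 2] leaves [2 K / q]. *)
have ia i : \int[mu]_w (a i w) <= 2 * K * i.+1%:R ^- 2.
  have i1 : 1 <= i.+1%:R :> R by rewrite ler1n.
  set q : R := i.+1%:R ^+ 2; have q1 : 1 <= q by rewrite expr_ge1.
  have q0 : 0 < q by lra.
  have -> : \int[mu]_w (a i w) = (q ^- 2) * \int[mu]_w (log_sum (Z^~ w) (sparse i) ^+ 2).
    rewrite -RintegralZl //; last first.
      by apply/bounded_mfun_integrable; apply: bounded_mfunM; exact: bounded_mfun_log_sum.
    by apply: eq_Rintegral => w _; rewrite /a -/q expr_div_n mulrC.
  have := Rintegral_sqr_log_sum_le Z M C g (sparse i) mZ ZM C0 gi cov.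
  rewrite -/K => h; rewrite mulrC ler_pdivrMr ?exprn_gt0 //.
  apply: (le_trans h); have := log_sum_cst1_le (R := R) (sparse i) (sparse_gt0 i).
  rewrite ln_sparse -/q => h'.
  have l2 : ln 2 <= 1 :> R by apply: (le_trans (le_ln1Dx _)); rewrite ?lerB //; lra.
  have -> : 2 * K / q * q ^+ 2 = K * (2 * q) by field; rewrite gt_eqF.
  apply: ler_wpM2l => //; apply: (le_trans h'); nra.
(* The sum and the integral are exchanged by nonnegativity; [4 K] is [2 K] times the bound 2 on the
   sum of inverse squares. *)
have fin : (\int[mu]_w (\sum_(0 <= i <oo) (a i w)%:E) <= (4 * K)%:E)%E.
  rewrite integral_nneseries //; last by move=> n w _; rewrite lee_fin.
  apply: lime_le; first by apply: is_cvg_nneseries => n _ _;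
    apply: integral_ge0 => w _; rewrite lee_fin.
  near=> n.
  apply: (@le_trans _ _ (\sum_(0 <= i < n) (2 * K * i.+1%:R ^- 2)%:E)%E).
    apply: lee_sum => i _; rewrite -[leLHS]fineK; first by rewrite lee_fin; exact: ia.
    exact/integrable_fin_num/bounded_mfun_integrable.
  rewrite sumEFin lee_fin -mulr_sumr.
  have -> : 4 * K = 2 * K * 2 by ring.
  by rewrite ler_wpM2l ?mulr_ge0 // sum_inv_sqr_le.
have int : mu.-integrable setT (fun w => \sum_(0 <= i <oo) (a i w)%:E)%E.
  apply/integrableP; split.
    by apply: ge0_emeasurable_sum => [k w _ _|k _]; [rewrite lee_fin|exact: ma].
  have s0 w : (0 <= \sum_(0 <= i <oo) (a i w)%:E)%E.
    by apply: nneseries_ge0 => i _ _; rewrite lee_fin.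
  under eq_integral do rewrite gee0_abs //.
  exact: le_lt_trans fin (ltry _).
have := integrable_ae measurableT int; apply: filterS => w /(_ I) /= finw.
have := cvg0_of_nneseries_fin_num (a^~ w) (a0^~ w) finw.
move=> aw; apply: (cvg_log_average (Z^~ w) M) => //.
apply/cvgr0Pnorm_lt => e e0.
move/cvgr0Pnorm_lt : aw => /(_ _ (exprn_gt0 2 e0)); apply: filterS => i.
by rewrite /a normrX ltr_pXn2r ?nnegrE ?normr_ge0 ?(ltW e0).
Unshelve. all: by end_near. Qed.

(** Convergence to [c] means that the upper limit of [|u n - c|] is 0, and that upper limit is a
    measurable function. Measurability is what turns an almost everywhere statement into a value of
    [mu] on the set itself. *)
Lemma measurable_cvg_set (u : nat -> T -> R) (c : R) :
  (forall n, measurable_fun setT (u n)) ->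
  measurable [set w | u n w @[n --> \oo] --> c].
Proof.
move=> mu_.
have mv n : measurable_fun setT (fun w => (`|u n w - c|)%:E).
  apply/measurable_EFinP; apply: measurableT_comp => //.
  by apply: measurable_funB => //; exact: measurable_cst.
have -> : [set w | u n w @[n --> \oo] --> c] =
    (fun w => limn_esup (fun n => (`|u n w - c|)%:E)) @^-1` [set 0%E].
  apply/seteqP; split => w /=.
    move=> h; apply: (cvg_limn_einf_sup _).2.
    apply: cvg_EFin; first exact: nearW.
    by have /cvg_norm : (u n w - c) @[n --> \oo] --> (0 : R);
      [exact/subr_cvg0|rewrite normr0].
  move=> h; have /fine_cvg /= : (fun n => (`|u n w - c|)%:E) @ \oo --> 0%E.
    by apply: limn_esup_le_cvg; [rewrite h | move=> n; rewrite lee_fin].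
  by move/norm_cvg0P => ?; exact/subr_cvg0.
have := measurable_fun_limn_esup mv measurableT (emeasurable_set1 0%E).
by rewrite setTI.
Qed.

Lemma probability_ae_eq1 (A : set T) : measurable A ->
  {ae mu, forall w, A w} -> mu A = 1%E.
Proof.
move=> mA [N [mN N0 AN]].
have : mu (~` A) = 0%E by apply: (subset_measure0 _ mN) => //; exact: measurableC.
rewrite probability_setC // => /eqP; rewrite sube_eq ?fin_num_measure //.
by rewrite add0e => /eqP.
Qed.

End AlmostSureLogAverages.

(** * Finiteness and continuity of the upper expectation *)

Section UpperExpectation.
Context {d : measure_display} {T : measurableType d} {R : realType}
  (Ps : set (probability T R)) (Ps0 : Ps !=set0).

(** What [sublinear_space] grants to the members of [H]. As [Ps] is nonempty, it makes [uE Ps Y]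
    finite, so [fine] loses nothing. *)
Definition uintegrable (Y : T -> R) : Prop :=
  (forall mu, Ps mu -> mu.-integrable setT (EFin \o Y)) /\ (uE Ps Y < +oo)%E.

Lemma le_uE (mu : probability T R) Y : Ps mu -> (\int[mu]_w (Y w)%:E <= uE Ps Y)%E.
Proof. by move=> Pmu; apply: ereal_sup_ubound; exists mu. Qed.

Lemma uE_le Y x :
  (forall mu : probability T R, Ps mu -> (\int[mu]_w (Y w)%:E <= x)%E) ->
  (uE Ps Y <= x)%E.
Proof. by move=> h; apply: ge_ereal_sup => _ [mu Pmu <-]; exact: h. Qed.

Lemma uE_fin_num Y : uintegrable Y -> uE Ps Y \is a fin_num.
Proof.
move=> [iY Yoo]; rewrite fin_numElt Yoo andbT.
have [mu Pmu] := Ps0; apply: lt_le_trans (le_uE _ Y Pmu).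
by rewrite ltNye_eq integrable_fin_num //; exact: iY.
Qed.

Lemma Rintegral_le_uE (mu : probability T R) Y : Ps mu -> uintegrable Y ->
  \int[mu]_w Y w <= fine (uE Ps Y).
Proof.
move=> Pmu uY; apply: fine_le; [|exact: uE_fin_num|exact: le_uE].
by apply: integrable_fin_num => //; exact: uY.1.
Qed.

Lemma fine_uE_le Y (x : R) : uintegrable Y ->
  (forall mu : probability T R, Ps mu -> \int[mu]_w Y w <= x) ->
  fine (uE Ps Y) <= x.
Proof.
move=> uY h; rewrite -lee_fin fineK ?uE_fin_num //; apply: uE_le => mu Pmu.
rewrite -[leLHS]fineK; first by rewrite lee_fin; exact: h.
by apply: integrable_fin_num => //; exact: uY.1.
Qed.

Lemma fine_uE_le_dist Y Z (e : R) : uintegrable Y -> uintegrable Z ->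
  (forall w, Y w <= Z w + e) -> fine (uE Ps Y) <= fine (uE Ps Z) + e.
Proof.
move=> uY uZ YZ; apply: fine_uE_le => // mu Pmu.
rewrite -lerBlDr; apply: le_trans (Rintegral_le_uE _ _ Pmu uZ).
rewrite lerBlDr -[X in _ + X](Rintegral_cst_prob mu) -RintegralD //.
- apply: le_Rintegral => //; first exact: uY.1.
  exact: (integrableD measurableT (uZ.1 _ Pmu)
    (bounded_mfun_integrable mu _ (bounded_mfun_cst e))).
- exact: uZ.1.
- exact/bounded_mfun_integrable/bounded_mfun_cst.
Qed.

(** Nonexpansiveness for the uniform distance: it lets upper expectations inherit bounds and
    Lipschitz constants in a parameter. *)
Lemma normr_fine_uE_dist Y Z (e : R) : uintegrable Y -> uintegrable Z ->
  (forall w, `|Y w - Z w| <= e) -> `|fine (uE Ps Y) - fine (uE Ps Z)| <= e.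
Proof.
move=> uY uZ h; rewrite ler_norml; apply/andP; split.
  rewrite lerNl opprB lerBlDl; apply: fine_uE_le_dist => // w.
  by have := h w; rewrite ler_norml => /andP[]; lra.
rewrite lerBlDl; apply: fine_uE_le_dist => // w.
by have := h w; rewrite ler_norml => /andP[]; lra.
Qed.

Lemma uE_cst (c : R) : uE Ps (fun=> c) = c%:E.
Proof.
have ic (mu : probability T R) : (\int[mu]_w c%:E)%E = c%:E.
  by rewrite integral_cst //= probability_setT mule1.
apply/eqP; rewrite eq_le uE_le => [|mu _]; last by rewrite ic.
by have [mu Pmu] := Ps0; rewrite -(ic mu) le_uE.
Qed.

Lemma bounded_mfun_uintegrable Y : bounded_mfun Y -> uintegrable Y.
Proof.
move=> bY; split=> [mu _|]; first exact: bounded_mfun_integrable.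
have [_ [M hM]] := bY; apply: (@le_lt_trans _ _ M%:E); last exact: ltry.
apply: uE_le => mu Pmu; rewrite -[leLHS]fineK; last first.
  exact/integrable_fin_num/bounded_mfun_integrable.
rewrite lee_fin -[leRHS](Rintegral_cst_prob mu); apply: le_Rintegral => //.
- exact: bounded_mfun_integrable.
- exact/bounded_mfun_integrable/bounded_mfun_cst.
- by move=> w _; rewrite (le_trans _ (hM w)) // ler_norm.
Qed.

End UpperExpectation.

(** * Bounded Lipschitz test functions on sequences *)

Section BoundedLipschitz.
Context {R : realType}.
Implicit Types (phi psi : (nat -> R) -> R) (x y : nat -> R).

(* Test functions of [n] variables are read off sequences, so that blocks of
   variables can be spliced without casts between ordinals. *)
Definition cblip_seq (n : nat) phi : Prop :=
  (exists M : R, forall x, `|phi x| <= M) /\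
  (exists2 L : R, 0 <= L &
     forall x y, `|phi x - phi y| <= L * \sum_(0 <= i < n) `|x i - y i|).

(** The Lipschitz bound sees the first [n] coordinates only, so dependence on these alone needs no
    separate clause. *)
Lemma cblip_seq_eq n phi x y : cblip_seq n phi ->
  (forall i, (i < n)%N -> x i = y i) -> phi x = phi y.
Proof.
move=> [_ [L L0 lip]] xy; apply/eqP; rewrite -subr_eq0 -normr_le0.
apply: (le_trans (lip x y)); rewrite big_nat big1 ?mulr0 // => i /andP[_ ni].
by rewrite xy // subrr normr0.
Qed.

Definition splice (j : nat) x y : nat -> R := fun i => if (i < j)%N then x i else y i.

Lemma cblip_seq_splice n j phi x : cblip_seq n phi ->
  cblip_seq n (fun y => phi (splice j x y)).
Proof.
move=> [[M bM] [L L0 lip]]; split; first by exists M.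
exists L => // y y'; apply: (le_trans (lip _ _)); rewrite ler_wpM2l //.
apply: ler_sum => i _; rewrite /splice; case: ifP => // _.
by rewrite subrr normr0.
Qed.

Lemma cblip_seq_widen m n phi : (m <= n)%N -> cblip_seq m phi -> cblip_seq n phi.
Proof.
move=> mn [bM [L L0 lip]]; split=> //; exists L => // x y.
apply: (le_trans (lip x y)); rewrite ler_wpM2l //.
rewrite (big_cat_nat (leq0n m) mn) //= lerDl; exact: sumr_ge0.
Qed.

Lemma cblip_seqM n phi psi : cblip_seq n phi -> cblip_seq n psi ->
  cblip_seq n (fun x => phi x * psi x).
Proof.
move=> [[M1 b1] [L1 L10 l1]] [[M2 b2] [L2 L20 l2]].
have M10 : 0 <= M1 by exact: le_trans (b1 (fun=> 0)).
have M20 : 0 <= M2 by exact: le_trans (b2 (fun=> 0)).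
split; first by exists (M1 * M2) => x; rewrite normrM ler_pM.
exists (M1 * L2 + M2 * L1); first by rewrite addr_ge0 ?mulr_ge0.
move=> x y; have -> : phi x * psi x - phi y * psi y =
  phi x * (psi x - psi y) + psi y * (phi x - phi y) by ring.
apply: (le_trans (ler_normD _ _)); rewrite !normrM mulrDl -!mulrA.
by apply: lerD; apply: ler_pM.
Qed.

Lemma cblip_seq_mean (f : R -> R) (M c : R) (j m : nat) :
  (forall u, `|f u| <= M) -> (forall u v, `|f u - f v| <= `|u - v|) -> 0 <= c ->
  cblip_seq (j + m) (fun x => f ((\sum_(i < m) x (j + i)%N) / c)).
Proof.
move=> fM flip c0; split; first by exists M.
exists c^-1; first by rewrite invr_ge0.
move=> x y; apply: (le_trans (flip _ _)).
rewrite -mulrBl normrM normfV (ger0_norm c0) mulrC ler_wpM2l ?invr_ge0 //.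
rewrite -sumrB (le_trans (ler_norm_sum _ _ _)) //.
rewrite (big_cat_nat (leq0n j) (leq_addr m j)) //= -[leLHS]add0r lerD //;
  first exact: sumr_ge0.
rewrite -[X in \sum_(X <= _ < _) _]add0n big_addn addKn big_mkord.
by under [leRHS]eq_bigr do rewrite addnC.
Qed.

(** Bridge to the tuples in [cblip] and [indep]. The default [c] doubles as coordinate [n], which is
    how a last variable is appended in [cblip_seq_cblip2]. *)
Definition ord_ext (n : nat) (x : 'I_n -> R) (c : R) : nat -> R :=
  fun i => oapp x c (insub i).

Lemma ord_ext_ord n (x : 'I_n -> R) c (i : 'I_n) : ord_ext n x c i = x i.
Proof. by rewrite /ord_ext valK. Qed.

Lemma ord_ext_ge n (x : 'I_n -> R) c i : (n <= i)%N -> ord_ext n x c i = c.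
Proof. by move=> ni; rewrite /ord_ext insubF // ltnNge ni. Qed.

Lemma ord_ext_lt n x c i : (i < n)%N -> ord_ext n (fun k : 'I_n => x k) c i = x i.
Proof. by move=> ni; exact: (ord_ext_ord _ _ _ (Ordinal ni)). Qed.

Lemma cblip_seq_cblip n phi : cblip_seq n phi ->
  cblip (fun x : 'I_n -> R => phi (ord_ext n x 0)).
Proof.
move=> [[M bM] [L L0 lip]]; split; first by exists M.
exists L => x y; apply: (le_trans (lip _ _)); rewrite big_mkord ler_wpM2l //.
by apply: ler_sum => i _; rewrite !ord_ext_ord.
Qed.

Lemma cblip_seq_cblip2 n phi : cblip_seq n.+1 phi ->
  cblip2 (fun (x : 'I_n -> R) c => phi (ord_ext n x c)).
Proof.
move=> [[M bM] [L L0 lip]]; split; first by exists M.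
exists L => x x' y y'; apply: (le_trans (lip _ _)).
rewrite ler_wpM2l // big_nat_recr //= big_mkord lerD ?ord_ext_ge //.
by apply: ler_sum => i _; rewrite !ord_ext_ord.
Qed.

End BoundedLipschitz.

(** * Conditioning on an initial block of independent variables *)

Section IndependentBlocks.
Context {d : measure_display} {T : measurableType d} {R : realType}
  (Ps : set (probability T R)) (H : set (T -> R)) (X : nat -> T -> R)
  (subH : sublinear_space Ps H) (HX : forall i, H (X i))
  (indX : indep_seq Ps X).

Let Ps0 : Ps !=set0. Proof. by case: subH. Qed.

Lemma uintegrable_H Y : H Y -> uintegrable Ps Y.
Proof. by case: subH => _ _ _ _ h /h. Qed.

Lemma cblip_seq_uintegrable n phi : cblip_seq n phi ->
  uintegrable Ps (fun w => phi (X^~ w)).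
Proof.
move=> cphi; apply: uintegrable_H.
have [_ _ Hc _ _] := subH.
have := Hc n (fun i => X i) _ HX (cblip_seq_cblip _ _ cphi).
congr (H _); apply/funext => w; apply: (cblip_seq_eq n) => // i ni.
exact: (ord_ext_lt n (X^~ w)).
Qed.

(** Under independence this plays the role of the upper expectation conditional on the first [j]
    variables, as a function of their values. *)
Definition cexp phi j (x : nat -> R) : R :=
  fine (uE Ps (fun w => phi (splice j x (X^~ w)))).

(** The conditional expectation is again a test function, with the same constants, so conditioning
    can be iterated. *)
Lemma cblip_seq_cexp n j phi : (j <= n)%N -> cblip_seq n phi ->
  cblip_seq j (cexp phi j).
Proof.
move=> jn cphi; have ui x : uintegrable Ps (fun w => phi (splice j x (X^~ w))).
  exact: (cblip_seq_uintegrable n (fun y => phi (splice j x y)) (cblip_seq_splice _ _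
    _ _ cphi)).
have := cphi; move=> [[M bM] [L L0 lip]]; split.
  (* The bound is read as a distance to the upper expectation of the constant 0. *)
  exists M => x; rewrite -[X in `|X|]subr0 -[X in _ - X]/(fine (0%:E)).
  rewrite -(uE_cst _ Ps0); apply: normr_fine_uE_dist => //.
    exact/bounded_mfun_uintegrable/bounded_mfun_cst.
  by move=> w; rewrite subr0.
exists L => // x y; apply: normr_fine_uE_dist => // w.
apply: (le_trans (lip _ _)); rewrite ler_wpM2l //.
rewrite (big_cat_nat (leq0n j) jn) //= -[leRHS]addr0; apply: lerD.
  rewrite big_nat [leRHS]big_nat; apply: ler_sum => i /andP[_ ij].
  by rewrite /splice ij.
rewrite big_nat big1 // => i /andP[ji _].
by rewrite /splice ltnNge ji /= subrr normr0.
Qed.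

Lemma uE_condition_last n phi : cblip_seq n.+1 phi ->
  uE Ps (fun w => phi (X^~ w)) = uE Ps (fun w => cexp phi n (X^~ w)).
Proof.
move=> cphi; have := indX n _ (cblip_seq_cblip2 _ _ cphi).
have e w w' : phi (ord_ext n (fun i : 'I_n => X i w) (X n w')) =
    phi (splice n (X^~ w) (X^~ w')).
  apply: (cblip_seq_eq n.+1) => // i; rewrite ltnS leq_eqVlt /splice => /predU1P[->|ni].
    by rewrite ord_ext_ge // ltnn.
  by rewrite ni; exact: (ord_ext_lt n (X^~ w)).
under [in X in X = _]eq_fun => w.
  rewrite (e w w); have -> : splice n (X^~ w) (X^~ w) = X^~ w.
    by apply/funext => i; rewrite /splice if_same.
  over.
move=> ->; congr (uE Ps _); apply/funext => w; rewrite /cexp.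
by congr (fine (uE Ps _)); apply/funext => w'.
Qed.

(** Independence speaks of one new variable at a time. The induction integrates out the last
    variable on both sides: unconditionally on the left, with the first [j] coordinates frozen on
    the right. *)
Lemma uE_condition_block j m phi : cblip_seq (j + m) phi ->
  uE Ps (fun w => phi (X^~ w)) = uE Ps (fun w => cexp phi j (X^~ w)).
Proof.
elim: m phi => [|m IHm] phi cphi.
  congr (uE Ps _); apply/funext => w; rewrite /cexp.
  have -> : (fun w' => phi (splice j (X^~ w) (X^~ w'))) = (fun=> phi (X^~ w)).
    apply/funext => w'; apply: (cblip_seq_eq (j + 0)) => // i.
    by rewrite addn0 /splice => ->.
  by rewrite uE_cst.
move: cphi; rewrite addnS => cphi.
have E w := uE_condition_last (j + m) _ (cblip_seq_splice _ j _ (X^~ w) cphi).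
rewrite (uE_condition_last (j + m) phi cphi).
rewrite (IHm _ (cblip_seq_cexp _ _ _ (leqnSn _) cphi)).
congr (uE Ps _); apply/funext => w.
rewrite [RHS]/cexp (E w) /cexp; congr (fine (uE Ps _)).
apply/funext => w'; congr (fine (uE Ps _)).
(* The two nested splices agree because [j <= j + m]. *)
apply/funext => w''; congr phi; apply/funext => i; rewrite /splice.
case: ltnP => // ij; case: ltnP => // ji;
  have : (i < j + m)%N by exact: leq_trans (leq_addr _ _).
by rewrite ltnNge ij.
Qed.

(** A single [mu] need not make the blocks independent, so the integral is first enlarged to the
    upper expectation. Conditioning freezes [a] to a constant of either sign, whence the two-sided
    bound on [h] under every measure of the family. *)
Lemma Rintegral_blocksM_le (mu : probability T R) j m (a h : (nat -> R) -> R) (A e : R) :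
  Ps mu -> cblip_seq j a -> cblip_seq (j + m) h ->
  (forall x y, h (splice j x y) = h y) -> (forall x, `|a x| <= A) ->
  (forall nu, Ps nu -> `|\int[nu]_w h (X^~ w)| <= e) ->
  \int[mu]_w (a (X^~ w) * h (X^~ w)) <= A * e.
Proof.
move=> Pmu ca ch hj aA he.
have A0 : 0 <= A by exact: le_trans (aA (fun=> 0)).
have cah : cblip_seq (j + m) (fun x => a x * h x).
  by apply: cblip_seqM => //; apply: cblip_seq_widen ca; exact: leq_addr.
have uh := cblip_seq_uintegrable _ _ ch.
apply: (le_trans (Rintegral_le_uE _ Ps0 _ _ Pmu (cblip_seq_uintegrable _ _ cah))).
have ce := cblip_seq_cexp _ j _ (leq_addr m j) cah.
rewrite (uE_condition_block j m _ cah); apply: (fine_uE_le _ Ps0) => [|nu Pnu].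
  exact: cblip_seq_uintegrable ce.
rewrite -[leRHS](Rintegral_cst_prob nu); apply: le_Rintegral => //.
- exact: (cblip_seq_uintegrable _ _ ce).1.
- exact/bounded_mfun_integrable/bounded_mfun_cst.
move=> w _; apply: (fine_uE_le _ Ps0) => [|nu' Pnu'].
  exact: (cblip_seq_uintegrable _ _ (cblip_seq_splice _ j _ (X^~ w) cah)).
have eqa w' : a (splice j (X^~ w) (X^~ w')) = a (X^~ w).
  by apply: (cblip_seq_eq j) => // i ij; rewrite /splice ij.
under eq_Rintegral do rewrite eqa hj.
rewrite RintegralZl //; last exact: uh.1.
by rewrite (le_trans (ler_norm _)) // normrM ler_pM // he.
Qed.

Lemma indep_seq_shift j : indep_seq Ps (fun i => X (j + i)%N).
Proof.
move=> n phi [[M bM] [L lip]].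
(* A test function of the shifted block is one of all variables that ignores the first [j]. *)
pose psi (x : 'I_(j + n) -> R) y := phi (fun i => x (rshift j i)) y.
suff /(indX (j + n)) : cblip2 psi by [].
split; first by exists M => x y; exact: bM.
(* [cblip2] fixes no sign for [L], and adding the ignored coordinates needs a nonnegative
   constant. *)
exists `|L| => x x' y y'; apply: (le_trans (lip _ _ _ _)).
apply: (@le_trans _ _ (`|L| * (\sum_(i < n) `|x (rshift j i) - x' (rshift j i)| + `|y
  - y'|))).
  by rewrite ler_wpM2r ?ler_norm // addr_ge0 // sumr_ge0.
rewrite ler_wpM2l // lerD2r big_split_ord /= lerDr; exact: sumr_ge0.
Qed.

End IndependentBlocks.

(** * Normalising constants and stability of the hypotheses under shifts *)

Section SongRate.
Context {d : measure_display} {T : measurableType d} {R : realType}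
  (Ps : set (probability T R)) (H : set (T -> R))
  (subH : sublinear_space Ps H).

Let Ps0 : Ps !=set0. Proof. by case: subH. Qed.

Lemma sig_bounds (m M : R) (X : nat -> T -> R) i : 0 < m ->
  (m%:E <= - uE Ps (fun w => (- X i w ^+ 2)%R))%E ->
  (uE Ps (fun w => (X i w ^+ 2)%R) <= M%:E)%E ->
  Num.sqrt m / 2 <= sig Ps X i <= Num.sqrt M.
Proof.
(* One measure of the family shows that the upper expectations of [X_i ^ 2] and [- X_i ^ 2] are at
   least [0] and [- M], so with [hm] and [hM] both are finite. *)
move=> m0 hm hM; have [mu Pmu] := Ps0.
set A := uE Ps (fun w => X i w ^+ 2) in hM *.
set B := uE Ps (fun w => - X i w ^+ 2) in hm *.
have I0 : (0 <= \int[mu]_w (X i w ^+ 2)%:E)%E.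
  by apply: integral_ge0 => w _; rewrite lee_fin sqr_ge0.
have IA : (\int[mu]_w (X i w ^+ 2)%:E <= A)%E by exact: le_uE.
have IB : (- (\int[mu]_w (X i w ^+ 2)%:E) <= B)%E.
  rewrite -integral_ge0N; last by move=> w _; rewrite lee_fin sqr_ge0.
  exact: (le_uE _ _ (fun w => - X i w ^+ 2)).
have A0 : (0 <= A)%E by exact: le_trans IA.
have fA : fine A <= M.
  by move: A0 hM; rewrite /A; case: (uE _ _) => [r| |] //=; rewrite lee_fin.
have BM : ((- M)%:E <= B)%E.
  by apply: le_trans IB; rewrite EFinN leeN2; exact: le_trans hM.
have [mB BM'] : m <= - fine B /\ - fine B <= M.
  move: BM hm; rewrite /B; case: (uE _ _) => [r| |] //=.
  by rewrite !lee_fin => h1 h2; split => //; rewrite lerNl.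
have s1 : Num.sqrt m <= slow Ps (X i) by rewrite /slow -/B ler_wsqrtr.
have s2 : slow Ps (X i) <= Num.sqrt M by rewrite /slow -/B ler_wsqrtr.
(* Only the sign of [sbar] enters the lower bound, hence [sqrt m / 2]. *)
have s3 : 0 <= sbar Ps (X i) by exact: sqrtr_ge0.
have s4 : sbar Ps (X i) <= Num.sqrt M by rewrite /sbar -/A ler_wsqrtr.
by rewrite /sig; apply/andP; split; lra.
Qed.

Lemma Bn_bounds (X : nat -> T -> R) (s0 s1 : R) n : 0 <= s0 ->
  (forall i, s0 <= sig Ps X i <= s1) ->
  s0 * Num.sqrt n%:R <= Bn Ps X n <= s1 * Num.sqrt n%:R.
Proof.
move=> s00 hs; have s10 : 0 <= s1 by have /andP[a b] := hs 0%N; lra.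
rewrite -(ger0_norm s00) -(ger0_norm s10) -!sqrtr_sqr -!sqrtrM ?sqr_ge0 //.
have e (s : R) : s ^+ 2 * n%:R = \sum_(i < n) s ^+ 2.
  by rewrite sumr_const card_ord mulr_natr.
rewrite !e /Bn; apply/andP; split; apply: ler_wsqrtr; apply: ler_sum => i _.
  by have /andP[a b] := hs i; rewrite lerXn2r ?nnegrE //; lra.
by have /andP[a b] := hs i; rewrite lerXn2r ?nnegrE //; lra.
Qed.

Lemma admissible_shift (beta : R) X j : admissible Ps H beta X ->
  admissible Ps H beta (fun i => X (j + i)%N).
Proof.
move=> [[HX indX] h2 h3 [m [m0 h4]] [M h5]]; split.
- by split; [move=> i; exact: HX | exact: indep_seq_shift].
- by move=> i; exact: h2.
- by move=> i; exact: h3.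
- by exists m; split=> // i; exact: h4.
- by exists M => i; exact: h5.
Qed.

Lemma H_Wn X n : (forall i, H (X i)) -> H (Wn Ps X n).
Proof.
move=> HX; have [_ [HD HZ] _ _ _] := subH.
have HS : H (fun w => \sum_(i < n) X i w).
  elim: n => [|n IHn].
    have := HZ 0 _ (HX 0%N); congr (H _); apply/funext => w.
    by rewrite mul0r big_ord0.
  have := HD _ _ IHn (HX n); congr (H _); apply/funext => w.
  by rewrite big_ord_recr.
by have := HZ (Bn Ps X n)^-1 _ HS; congr (H _); apply/funext => w; rewrite mulrC.
Qed.

Lemma bounded_mfun_Lip1_Wn X n (g : R -> R) (M : R) : (forall i, H (X i)) ->
  (forall x, `|g x| <= M) -> (forall x y, `|g x - g y| <= `|x - y|) ->
  bounded_mfun (fun w => g (Wn Ps X n w)).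
Proof.
move=> HX gM lip; split; last by exists M.
have [_ _ _ mH _] := subH.
by apply: measurableT_comp; [exact: measurable_Lip1 | exact/mH/H_Wn].
Qed.

End SongRate.

(** * Uniform convergence rate, first moments and decay of covariances *)

Section Covariance.
Context {d : measure_display} {T : measurableType d} {R : realType}
  (Ps : set (probability T R)) (H : set (T -> R))
  {d' : measure_display} {T' : measurableType d'}
  (Pt : set (probability T' R)) (Ht : set (T' -> R))
  (X : nat -> T -> R) (xi : T' -> R) (beta alpha : R)
  (subH : sublinear_space Ps H) (subHt : sublinear_space Pt Ht)
  (Hxi : Ht xi) (xi2 : (uE Pt (fun w => (xi w ^+ 2)%R) < +oo)%E)
  (alphai : 0 < alpha < 1)
  (song : exists C : R, 0 < C /\
     forall Y : nat -> T -> R, admissible Ps H beta Y ->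
       song_bound Ps Pt xi alpha C Y)
  (admX : admissible Ps H beta X)
  (momX : exists M : R, forall i,
     (uE Ps (fun w => (`|X i w| `^ (2 + alpha))%R) <= M%:E)%E).

Let Ps0 : Ps !=set0. Proof. by case: subH. Qed.
Let Pt0 : Pt !=set0. Proof. by case: subHt. Qed.
Let HX i : H (X i). Proof. by case: admX => -[]. Qed.
Let alpha0 : 0 < alpha. Proof. by case/andP: alphai. Qed.

(** [Bn] is of order [sqrt n], so a rate [Bn ^ (- alpha)] is a rate [n ^ (- gam)]. *)
Let gam : R := alpha / 2.
Let W j n := Wn Ps (fun i => X (j + i)%N) n.

Lemma sig_bounded : exists s0 s1, 0 < s0 /\ forall i, s0 <= sig Ps X i <= s1.
Proof.
have [_ _ _ [m [m0 hm]] [M hM]] := admX.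
exists (Num.sqrt m / 2), (Num.sqrt M); split; first by rewrite divr_gt0 // sqrtr_gt0.
by move=> i; exact: (sig_bounds _ _ subH).
Qed.

(** Song's constant is common to all admissible sequences and the bounds on moments and variances
    survive shifts, so [D] does not depend on [j]. *)
Lemma song_rate : exists2 D, 0 <= D & forall j n (g : R -> R), (0 < n)%N ->
  (forall x y, `|g x - g y| <= `|x - y|) ->
  (`|uE Ps (fun w => g (W j n w)) - uE Pt (fun w => g (xi w))|
    <= (D / n%:R `^ gam)%:E)%E.
Proof.
have [C [C0 hC]] := song; have [M hM] := momX.
have [s0 [s1 [s00 hs]]] := sig_bounded.
have s10 : 0 < s1 by have /andP[a b] := hs 0%N; lra.
(* Each factor bounds one factor of Song's maximum, the last after [n ^ (- gam)] is taken out of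
   [(sigma_i / B_n) ^ alpha]. *)
pose D := C * (`|M| * (s0 `^ (2 + alpha))^-1 * (s1 / s0) `^ alpha).
exists D; first by rewrite !mulr_ge0 ?invr_ge0 ?powR_ge0 // ltW.
move=> j n g n0 lip.
have := hC _ (admissible_shift _ _ beta X j admX) n n0 g lip.
move/le_trans; apply.
rewrite /D -(mulrA C) EFinM; apply: lee_wpmul2l; first by rewrite lee_fin ltW.
have np : 0 < n%:R :> R by rewrite ltr0n.
apply: bigmax_le => [|i _].
  by rewrite lee_fin !mulr_ge0 ?invr_ge0 ?powR_ge0.
set Y := fun i => X (j + i)%N.
have hsY k : s0 <= sig Ps Y k <= s1 by exact: hs.
have /andP[B0 _] := Bn_bounds Ps Y s0 s1 n (ltW s00) hsY.
have sn : 0 < Num.sqrt n%:R :> R by rewrite sqrtr_gt0.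
have Bp : 0 < Bn Ps Y n by apply: lt_le_trans B0; rewrite mulr_gt0.
have /andP[si0 si1] := hsY i.
have sip : 0 < sig Ps Y i by lra.
have a0 : 0 <= (sig Ps Y i `^ (2 + alpha))^-1 by rewrite invr_ge0 powR_ge0.
have b0 : 0 <= (sig Ps Y i / Bn Ps Y n) `^ alpha by exact: powR_ge0.
apply: (@le_trans _ _ (`|M|%:E * ((sig Ps Y i `^ (2 + alpha))^-1)%:E
             * ((sig Ps Y i / Bn Ps Y n) `^ alpha)%:E)%E).
  apply: lee_wpmul2r; first by rewrite lee_fin.
  apply: lee_wpmul2r; first by rewrite lee_fin.
  by apply: (le_trans (hM _)); rewrite lee_fin ler_norm.
move: (sig Ps Y i) si0 si1 sip a0 b0 => s si0 si1 sip a0 b0.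
rewrite -!EFinM lee_fin -!mulrA; apply: ler_wpM2l => //; apply: ler_pM => //.
  rewrite lef_pV2 ?posrE ?powR_gt0 //.
  by have al0 := alpha0; apply: ge0_ler_powR; rewrite ?nnegrE //; lra.
have -> : n%:R `^ gam = Num.sqrt n%:R `^ alpha.
  by rewrite -powR12_sqrt ?ler0n // -powRrM /gam; congr (_ `^ _); lra.
have r0 : 0 <= s1 / s0 by rewrite divr_ge0 // ltW.
rewrite -powR_invl ?sqrtr_ge0 // -powRM ?invr_ge0 ?sqrtr_ge0 //.
have e0 : 0 <= s / Bn Ps Y n by rewrite divr_ge0 // ltW.
have e1 : 0 <= s1 / s0 / Num.sqrt n%:R by rewrite divr_ge0 // ltW.
apply: ge0_ler_powR; rewrite ?nnegrE ?(ltW alpha0) //.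
rewrite -mulrA -invfM; apply: ler_pM => //; rewrite ?invr_ge0 ?(ltW sip) ?(ltW Bp) //.
by rewrite lef_pV2 ?posrE // mulr_gt0.
Qed.

(** From [|x| <= 1 + x ^ 2]. *)
Lemma uE_xi_abs_lty : (uE Pt (fun w => `|xi w|%R) < +oo)%E.
Proof.
have [_ _ _ mHt _] := subHt; have mxi := mHt _ Hxi.
apply: (@le_lt_trans _ _ (1 + uE Pt (fun w => (xi w ^+ 2)%R))%E); last first.
  by rewrite lte_add_pinfty // ltry.
apply: uE_le => P PP.
apply: (@le_trans _ _ (1 + \int[P]_w (xi w ^+ 2)%:E)%E); last first.
  by rewrite leeD2l // (le_uE _ _ (fun w => xi w ^+ 2)).
have -> : 1%E = (\int[P]_w 1%:E)%E by rewrite integral_cst //= probability_setT mule1.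
have m2 : measurable_fun setT (fun w => (xi w ^+ 2)%:E).
  by apply/measurable_EFinP; exact: measurable_funX.
rewrite -ge0_integralD //; last by move=> w _; rewrite lee_fin sqr_ge0.
apply: ge0_le_integral => //.
- by apply/measurable_EFinP; exact: measurableT_comp.
- by apply: emeasurable_funD => //; exact: measurable_cst.
- move=> w _; rewrite -EFinD lee_fin -(real_normK (num_real (xi w))).
  by have := sqr_ge0 (`|xi w| - 1); have := normr_ge0 (xi w); nra.
Qed.

Lemma integrable_W j n mu : Ps mu -> mu.-integrable setT (EFin \o (W j n)).
Proof.
by move=> Pmu; apply: (uintegrable_H _ _ subH _ _).1 => //; apply: H_Wn => // i.
Qed.

Lemma integrable_abs_W j n mu : Ps mu ->
  mu.-integrable setT (EFin \o (fun w => `|W j n w|)).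
Proof. by move=> Pmu; exact: (integrable_norm (integrable_W j n mu Pmu)). Qed.

(** The absolute value is 1-Lipschitz, so the rate compares the first moment with that of [xi], up
    to [D / n ^ gam <= D]. *)
Lemma first_moment : exists2 K, 0 <= K & forall j n (mu : probability T R),
  (0 < n)%N -> Ps mu -> \int[mu]_w `|W j n w| <= K.
Proof.
have [D D0 hD] := song_rate.
have x0 : (0 <= uE Pt (fun w => `|xi w|%R))%E.
  have [P PP] := Pt0; apply: le_trans (le_uE _ _ _ PP).
  by apply: integral_ge0 => w _; rewrite lee_fin.
have xf : uE Pt (fun w => `|xi w|%R) \is a fin_num.
  by rewrite ge0_fin_numE // uE_xi_abs_lty.
exists (fine (uE Pt (fun w => `|xi w|%R)) + D); first by rewrite addr_ge0 // fine_ge0.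
move=> j n mu n0 Pmu; rewrite -lee_fin fineK; last first.
  exact/integrable_fin_num/integrable_abs_W.
apply: (le_trans (le_uE _ mu (fun w => `|W j n w|) Pmu)).
apply: (le_trans (lee_of_dist _ _ _ xf (hD j n Num.norm n0 _))).
  by move=> x y; exact: ler_dist_dist.
rewrite -[in leLHS](fineK xf) -EFinD lee_fin lerD2l ler_pdivrMr ?powR_gt0 ?ltr0n //.
rewrite ler_peMr // -[leLHS](powRr0 n%:R); apply: ler_powR; first by rewrite ler1n.
by rewrite divr_ge0 // ltW.
Qed.

(** With [m = k - j], the later block [W j m] replaces [W_k]. The product of the two blocks
    contributes [M D / m ^ gam], the replacement [2 M K rho] with [rho = B_j / B_k]; both are
    [O((j / k) ^ gam)]. *)
Lemma cov_le (g : R -> R) (M : R) :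
  (forall x, `|g x| <= M) -> (forall x y, `|g x - g y| <= `|x - y|) ->
  (forall P : probability T' R, Pt P -> (\int[P]_w (g (xi w))%:E = 0)%E) ->
  exists2 C, 0 <= C & forall (mu : probability T R) j k, Ps mu -> (0 < j < k)%N ->
    \int[mu]_w (g (Wn Ps X j w) * g (Wn Ps X k w)) <=
      C * (j%:R `^ gam / k%:R `^ gam).
Proof.
move=> gM lip gxi.
have [D D0 hD] := song_rate; have [K K0 hK] := first_moment.
have [s0 [s1 [s00 hs]]] := sig_bounded.
have s10 : 0 < s1 by have /andP[a b] := hs 0%N; lra.
have M0 : 0 <= M by exact: le_trans (gM 0).
have gam0 : 0 < gam by rewrite divr_gt0.
have gam2 : gam <= 2^-1 by rewrite /gam; move: alphai => /andP[]; lra.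
have r0 : 0 <= s1 / s0 by rewrite divr_ge0 // ltW.
exists (M * (2 * D) + M * (K * (s1 / s0) * 2)).
  by apply: addr_ge0; apply: mulr_ge0 => //; apply: mulr_ge0 => //; apply: mulr_ge0.
move=> mu j k Pmu /andP[j0 jk].
pose m := (k - j)%N; have m0 : (0 < m)%N by rewrite subn_gt0.
have ek : k = (j + m)%N by rewrite subnKC // ltnW.
clearbody m.
(* Since [k <= 2 j m], [1 / m ^ gam] is at most [2 (j / k) ^ gam], whether the later block is long
   or short. *)
have jm2 : (j + m <= 2 * j * m)%N by clear -j0 m0; nia.
have jp : 0 < j%:R :> R by rewrite ltr0n.
have kp : 0 < k%:R :> R by rewrite ltr0n; exact: leq_trans jk.
have mp : 0 < m%:R :> R by rewrite ltr0n.
have jgp : 0 < j%:R `^ gam by exact: powR_gt0.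
have kgp : 0 < k%:R `^ gam by exact: powR_gt0.
have mgp : 0 < m%:R `^ gam by exact: powR_gt0.
set q := j%:R `^ gam / k%:R `^ gam; have q0 : 0 < q by rewrite divr_gt0.
have mq : (m%:R `^ gam)^-1 <= 2 * q.
  rewrite /q mulrA ler_pdivlMr // mulrC ler_pdivrMr //.
  apply: (@le_trans _ _ ((2 * j%:R * m%:R) `^ gam)).
    apply: ge0_ler_powR; rewrite ?nnegrE -?natrM ?ler0n ?(ltW gam0) //.
    by rewrite ler_nat ek.
  rewrite powRM ?mulr_ge0 // powRM //; rewrite ler_wpM2r ?powR_ge0 //.
  rewrite ler_wpM2r ?powR_ge0 // -[leRHS](powRr1 (ler0n R 2)).
  by apply: ler_powR; [rewrite ler1n|lra].
have /andP[Bjl Bj1] := Bn_bounds Ps X s0 s1 j (ltW s00) hs.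
have /andP[Bk0 _] := Bn_bounds Ps X s0 s1 k (ltW s00) hs.
have Bj0 : 0 <= Bn Ps X j by exact: sqrtr_ge0.
have Bkp : 0 < Bn Ps X k by apply: lt_le_trans Bk0; rewrite mulr_gt0 // sqrtr_gt0.
set rho := Bn Ps X j / Bn Ps X k.
have rho0 : 0 <= rho by rewrite divr_ge0 // ltW.
have rhoq : rho <= s1 / s0 * q.
  apply: (@le_trans _ _ (s1 / s0 * (Num.sqrt j%:R / Num.sqrt k%:R))).
    rewrite mulrACA -invfM; apply: ler_pM => //; first by rewrite invr_ge0 ltW.
    by rewrite lef_pV2 ?posrE // mulr_gt0 // sqrtr_gt0.
  rewrite ler_wpM2l // -!powR12_sqrt ?ler0n // /q.
  rewrite -!powR_invl ?ler0n // -!powRM ?invr_ge0 ?ler0n //.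
  (* [(j / k) ^ (1 / 2) <= (j / k) ^ gam] because [j / k <= 1] and [gam <= 1 / 2]. *)
  apply: ger_powR => //; rewrite divr_gt0 //= ler_pdivrMr // mul1r ler_nat.
  exact: ltnW.
set B' := Bn Ps (fun i => X (j + i)%N) m.
have B'p : 0 < B'.
  have /andP[h _] := Bn_bounds Ps (fun i => X (j + i)%N) s0 s1 m (ltW s00) (fun i =>
    hs _).
  by apply: lt_le_trans h; rewrite mulr_gt0 // sqrtr_gt0.
have BB : Bn Ps X k ^+ 2 = Bn Ps X j ^+ 2 + B' ^+ 2.
  rewrite /B' /Bn !sqr_sqrtr ?sumr_ge0 // => [|i _|i _|i _]; rewrite ?sqr_ge0 //.
  by rewrite ek big_split_ord.
(* By Pythagoras [B' <= B_k <= B_j + B']. *)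
have rho1 : `|B' / Bn Ps X k - 1| <= rho.
  have B'k : B' <= Bn Ps X k.
    by rewrite -(@ler_pXn2r _ 2) ?nnegrE ?(ltW B'p) ?(ltW Bkp) // BB lerDr sqr_ge0.
  have kB : Bn Ps X k <= Bn Ps X j + B'.
    rewrite -(@ler_pXn2r _ 2) ?nnegrE ?addr_ge0 ?(ltW B'p) ?(ltW Bkp) // BB.
    by have := mulr_ge0 Bj0 (ltW B'p); nra.
  rewrite ler0_norm; last by rewrite subr_le0 ler_pdivrMr // mul1r.
  rewrite opprB lerBlDr -mulrDl ler_pdivlMr // mul1r //.
have decomp w : Wn Ps X k w - W j m w =
    W 0 j w * rho + W j m w * (B' / Bn Ps X k - 1).
  have Sj : \sum_(i < j) X i w = W 0 j w * Bn Ps X j.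
    have -> : W 0 j w = Wn Ps X j w by [].
    by rewrite /Wn divfK // gt_eqF // (lt_le_trans _ Bjl) // mulr_gt0 // sqrtr_gt0.
  have Sm : \sum_(i < m) X (j + i)%N w = W j m w * B'.
    by rewrite /W /Wn -/B' divfK // gt_eqF.
  have -> : Wn Ps X k w = (\sum_(i < j) X i w + \sum_(i < m) X (j + i)%N w) / Bn Ps X k.
    by rewrite /Wn; congr (_ / _); rewrite ek big_split_ord.
  rewrite Sj Sm /rho; field; by rewrite gt_eqF.
have dist w : `|Wn Ps X k w - W j m w| <= rho * (`|W 0 j w| + `|W j m w|).
  rewrite decomp (le_trans (ler_normD _ _)) // (normrM (W 0 j w) rho).
  rewrite (normrM (W j m w)) (ger0_norm rho0) mulrDr.
  by apply: lerD; rewrite mulrC // ler_wpM2r.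
(* The form [0 + i] matches [cblip_seq_mean] for a block starting at 0. *)
pose a (x : nat -> R) := g ((\sum_(i < j) x (0 + i)%N) / Bn Ps X j).
pose h (x : nat -> R) := g ((\sum_(i < m) x (j + i)%N) / B').
have ca : cblip_seq j a by exact: (cblip_seq_mean g M (Bn Ps X j) 0 j).
have ch : cblip_seq (j + m) h by apply: (cblip_seq_mean g M B' j m) => //; exact: ltW.
have hh x y : h (splice j x y) = h y.
  congr (g (_ / _)); apply: eq_bigr => i _.
  by rewrite /splice ltnNge leq_addr.
have bg i n : bounded_mfun (fun w => g (W i n w)).
  exact: (bounded_mfun_Lip1_Wn _ _ subH _ _ g M).
have eps (nu : probability T R) : Ps nu -> `|\int[nu]_w h (X^~ w)| <= D / m%:R `^ gam.
  move=> Pnu.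
  (* An upper expectation bounds integrals from above only; applying this to [g] and to [- g] gives
     the absolute value. *)
  have one (s : R -> R) : (forall x y, `|s x - s y| <= `|x - y|) ->
      (forall x, `|s x| <= M) ->
      (forall P : probability T' R, Pt P -> (\int[P]_w (s (xi w))%:E = 0)%E) ->
      \int[nu]_w s (W j m w) <= D / m%:R `^ gam.
    move=> slip sM sxi.
    have u0 : uE Pt (fun w => s (xi w)) = 0%E.
      apply/eqP; rewrite eq_le uE_le => [|P PP]; last by rewrite sxi.
      by have [P PP] := Pt0; rewrite -(sxi P PP) (le_uE _ _ (fun w => s (xi w))).
    have := hD j m s m0 slip; rewrite u0 => /lee_of_dist.
    rewrite add0e => /(_ isT) le.
    rewrite -lee_fin fineK.
      exact: le_trans (le_uE _ _ (fun w => s (W j m w)) Pnu) le.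
    apply/integrable_fin_num => //; apply: bounded_mfun_integrable.
    exact: (bounded_mfun_Lip1_Wn _ _ subH _ _ s M).
  have -> : \int[nu]_w h (X^~ w) = \int[nu]_w g (W j m w) by [].
  rewrite ler_norml one // andbT lerNl.
  have -> : - (\int[nu]_w g (W j m w)) = \int[nu]_w (- g (W j m w)).
    under [RHS]eq_Rintegral do rewrite -mulN1r.
    by rewrite RintegralZl ?mulN1r //; exact: bounded_mfun_integrable.
  apply: (one (fun x => - g x)) => [x y|x|P PP].
  - by rewrite -opprD normrN lip.
  - by rewrite normrN.
  - under eq_integral do rewrite EFinN.
    rewrite integralN ?gxi ?oppe0 //; apply: integrable_add_def => //.
    apply: bounded_mfun_integrable; split; last by exists M.
    have [_ _ _ mHt _] := subHt.
    by apply: measurableT_comp; [exact: measurable_Lip1 | exact: mHt].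
have [[_ indX] _ _ _ _] := admX.
have main := Rintegral_blocksM_le Ps H X subH HX indX mu j m a h M _ Pmu ca ch hh
  (fun=> gM _) eps.
have iN i n := integrable_abs_W i n mu Pmu.
have iS : mu.-integrable setT (EFin \o (fun w => `|W 0 j w| + `|W j m w|)).
  exact: (integrableD measurableT (iN _ _) (iN _ _)).
have iah : mu.-integrable setT (EFin \o (fun w => a (X^~ w) * h (X^~ w))).
  by apply: bounded_mfun_integrable; apply: (bounded_mfunM _ _ (bg 0%N j) (bg j m)).
have iSM : mu.-integrable setT
    (EFin \o (fun w => M * rho * (`|W 0 j w| + `|W j m w|))).
  exact: (integrableZl measurableT (M * rho) iS).
apply: (@le_trans _ _ (\int[mu]_w (a (X^~ w) * h (X^~ w) +
    M * rho * (`|W 0 j w| + `|W j m w|)))).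
  apply: le_Rintegral => //.
  - by apply: bounded_mfun_integrable; exact: (bounded_mfunM _ _ (bg 0%N j) (bg 0%N k)).
  - exact: (integrableD measurableT iah iSM).
  move=> w _; have -> : a (X^~ w) = g (Wn Ps X j w) by [].
  have -> : h (X^~ w) = g (W j m w) by [].
  rewrite -lerBlDl -mulrBr (le_trans (ler_norm _)) // normrM -mulrA.
  by apply: ler_pM => //; apply: le_trans (dist w); exact: lip.
rewrite RintegralD // RintegralZl // RintegralD // mulrDl; apply: lerD.
  apply: (le_trans main); rewrite -!mulrA ler_wpM2l //.
  by rewrite mulrCA ler_wpM2l.
apply: (@le_trans _ _ (M * rho * (K + K))).
  by apply: ler_wpM2l; [exact: mulr_ge0 | apply: lerD; exact: hK].
have -> : M * (K * (s1 / s0) * 2) * q = M * (s1 / s0 * q) * (K + K) by ring.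
by rewrite ler_wpM2r ?addr_ge0 // ler_wpM2l.
Qed.

End Covariance.

(** * Convergence of the logarithmic averages with lower probability one *)

Theorem theorem4p1
  (R : realType) (beta : R)
  (d : measure_display) (T : measurableType d)
  (Ps : set (probability T R)) (H : set (T -> R))
  (d' : measure_display) (T' : measurableType d')
  (Pt : set (probability T' R)) (Ht : set (T' -> R))
  (X : nat -> T -> R) (xi : T' -> R) (alpha : R) (f : R -> R) :
  1 <= beta ->
  sublinear_space Ps H -> sublinear_space Pt Ht ->
  condA Ps H -> condA Pt Ht ->
  G_normal Pt Ht xi ->
  Num.sqrt (fine (uE Pt (fun w => xi w ^+ 2))) = 2 * beta / (1 + beta) ->
  Num.sqrt (- fine (uE Pt (fun w => - xi w ^+ 2))) = 2 / (1 + beta) ->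
  (* alpha is the exponent of Song's Theorem 5.1 *)
  0 < alpha < 1 ->
  (exists C : R, 0 < C /\
     forall Y : nat -> T -> R, admissible Ps H beta Y ->
       song_bound Ps Pt xi alpha C Y) ->
  admissible Ps H beta X ->
  (exists M : R, forall i, (uE Ps (fun w => (`|X i w| `^ (2 + alpha))%R) <= M%:E)%E) ->
  Hclass Pt xi f ->
  lcap Ps [set w | (fun n : nat => (ln n%:R)^-1 *
        \sum_(1 <= k < n.+1) (k%:R)^-1 * f (Wn Ps X k w))
      @ \oo --> fine (uE Pt (fun w' => f (xi w')))] = 1%E.
Proof.
move=> _ subH subHt _ _ [Hxi xi2 _] _ _ alphai song admX momX [[[Mf fM] [Lf flip]] fxi].
have [Ps0 _ _ mH _] := subH; have [Pt0 _ _ mHt _] := subHt.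
have HX i : H (X i) by case: admX => -[].
set c := fine (uE Pt (fun w' => f (xi w'))).
(* Adding 1 makes the divisor positive even if [Lf] is 0. *)
pose L := `|Lf| + 1; have L0 : 0 < L by rewrite ltr_wpDl.
pose g x := (f x - c) / L.
have fg x : f x = c + L * g x by rewrite /g mulrC divfK ?gt_eqF // addrC subrK.
have glip x y : `|g x - g y| <= `|x - y|.
  rewrite /g -mulrBl opprB addrA subrK normrM normfV (gtr0_norm L0) ler_pdivrMr //.
  rewrite mulrC (le_trans (flip x y)) // ler_wpM2r // (le_trans (ler_norm _)) //.
  by rewrite lerDl.
pose M := (Mf + `|c|) / L.
have gM x : `|g x| <= M.
  rewrite /g normrM normfV (gtr0_norm L0) ler_pM2r ?invr_gt0 //.
  by rewrite (le_trans (ler_normB _ _)) // lerD2r.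
have bgxi : bounded_mfun (fun w => g (xi w)).
  split; last by exists M.
  by apply: measurableT_comp; [exact: measurable_Lip1 | exact: mHt].
have bLg : bounded_mfun (fun w => L * g (xi w)).
  by apply: bounded_mfunM => //; exact: bounded_mfun_cst.
have bfxi : bounded_mfun (fun w => f (xi w)).
  by under eq_fun do rewrite fg; apply: bounded_mfunD => //; exact: bounded_mfun_cst.
have bNfxi : bounded_mfun (fun w => - f (xi w)).
  by under eq_fun do rewrite -mulN1r; apply: bounded_mfunM => //; exact: bounded_mfun_cst.
(* Membership in [Hclass] makes upper and lower expectation of [f(xi)] equal, which squeezes every
   mean to [c]. *)
have Rf (P : probability T' R) : Pt P -> \int[P]_w f (xi w) = c.
  move=> PP; apply/eqP; rewrite eq_le; apply/andP; split.
    exact: (Rintegral_le_uE _ Pt0 _ _ PP (bounded_mfun_uintegrable _ _ bfxi)).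
  have := Rintegral_le_uE _ Pt0 _ _ PP (bounded_mfun_uintegrable _ _ bNfxi).
  have -> : fine (uE Pt (fun w => - f (xi w))) = - c.
    by rewrite /c fxi fineN opprK.
  under eq_Rintegral do rewrite -mulN1r.
  by rewrite RintegralZl ?mulN1r ?lerN2 //; exact: bounded_mfun_integrable.
have gxi (P : probability T' R) : Pt P -> (\int[P]_w (g (xi w))%:E = 0)%E.
  move=> PP; have := Rf P PP; under eq_Rintegral do rewrite fg.
  rewrite RintegralD //; [|exact/bounded_mfun_integrable/bounded_mfun_cst|exact:
    bounded_mfun_integrable].
  rewrite Rintegral_cst_prob RintegralZl //; last exact: bounded_mfun_integrable.
  move/eqP; rewrite -subr_eq0 addrAC subrr add0r mulf_eq0 gt_eqF //= => /eqP int0.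
  rewrite -[LHS]fineK; first by congr EFin.
  exact/integrable_fin_num/bounded_mfun_integrable.
have [C C0 cov] := cov_le Ps H Pt Ht X xi beta alpha subH subHt Hxi xi2 alphai song
  admX momX g M gM glip gxi.
have bgW k := bounded_mfun_Lip1_Wn Ps H subH X k g M HX gM glip.
set A := [set w | _].
have AE : A = [set w | (fun n : nat => (ln n%:R)^-1 * log_sum (fun k => f (Wn Ps X k
  w)) n) @ \oo --> c] by [].
have mA : measurable A.
  rewrite AE; apply: measurable_cvg_set => n; apply: measurable_funM;
    first exact: measurable_cst.
  apply: measurable_sum => k; apply: measurable_funM; first exact: measurable_cst.
  under eq_fun do rewrite fg.
  apply: measurable_funD; first exact: measurable_cst.
  by apply: measurable_funM; [exact: measurable_cst | case: (bgW k)].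
have PA (mu : probability T R) : Ps mu -> mu A = 1%E.
  move=> Pmu; apply: probability_ae_eq1 => //.
  have : {ae mu, forall w, (ln n%:R)^-1 * log_sum (fun k => g (Wn Ps X k w)) n @[n
    --> \oo] --> (0 : R)}.
    apply: (ae_cvg_log_average mu (fun k w => g (Wn Ps X k w)) M C (alpha / 2)) => //.
    - by move=> k; case: (bgW k).
    - by move: alphai => /andP[a0 a1]; apply/andP; split; lra.
    - by move=> j k jk; exact: cov.
  apply: filterS => w gw; rewrite AE /=.
  (* Since [f = c + L g], the average is [c] times the harmonic number over [ln n], which tends to
     [c], plus a null term. *)
  have -> : (fun n : nat => (ln n%:R)^-1 * log_sum (fun k => f (Wn Ps X k w)) n) =
      (fun n => c * ((ln n%:R)^-1 * log_sum (cst 1) n)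
        + L * ((ln n%:R)^-1 * log_sum (fun k => g (Wn Ps X k w)) n)).
    apply/funext => n; rewrite (mulrCA c) (mulrCA L) -mulrDr -(log_sumZ c) -(log_sumZ
      L); congr (_ * _).
    by rewrite /log_sum -big_split /=; apply: eq_bigr => k _; rewrite -mulrDr mulr1 -fg.
  have cE : c * 1 + L * 0 = c by rewrite mulr1 mulr0 addr0.
  rewrite -[X in _ --> X]cE.
  exact: (cvgD (cvgM (cvg_cst c) cvg_log_sum_cst1) (cvgM (cvg_cst L) gw)).
rewrite /lcap; have -> : [set mu A | mu in Ps] = [set 1%E].
  apply/seteqP; split => [_ [mu Pmu <-]|_ ->] /=; first exact: PA.
  by have [mu Pmu] := Ps0; exists mu => //; exact: PA.
exact: ereal_inf1.
Qed.
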